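(* Let $m\ge 2$ and let $C=\{c_0,\ldots,c_{m-1}\}$ be a set of $m$ odd integers such that $C\equiv\{1,3\}\pmod 4$. For $\mathbf{i}=i_1i_2\cdots\in\Sigma_m^\infty$ put $$\Lambda(\mathbf{i})=\left\{\sum_{k=1}^n 4^{k-1}a_k:\ a_k\in\{0,c_{i_k}\},\ n\ge 1\right\}.$$ Then the set $$\mathcal{N}=\{\mathbf{i}\in\Sigma_m^\infty:\ \Lambda(\mathbf{i})\text{ is not a spectrum for the measure }\mu_4\}$$ satisfies $\tilde\mu(\mathcal{N})=0$.
   Context: $\mu_4$ denotes the middle-fourth Cantor measure: the unique Borel probability measure on $\mathbb{R}$ satisfying $\mu_4(\cdot)=\frac12\mu_4\circ\tau_1^{-1}(\cdot)+\frac12\mu_4\circ\tau_2^{-1}(\cdot)$, where $\tau_1(x)=4^{-1}x$ and $\tau_2(x)=4^{-1}(x+2)$. A discrete set $\Lambda\subseteq\mathbb{R}$ is a spectrum for a Borel probability measure $\mu$ on $\mathbb{R}$ if the family $\{e^{2\pi i\lambda x}:\lambda\in\Lambda\}$ is an orthonormal basis of $L^2(\mu)$. $\Sigma_m^\infty=\{0,1,\ldots,m-1\}^\infty$ is the space of infinite words over $\{0,\ldots,m-1\}$. For a finite word $i_1\cdots i_n$, the cylinder set $[i_1\cdots i_n]$ is the set of words in $\Sigma_m^\infty$ that begin with $i_1\cdots i_n$. The cylinder sets generate the Borel $\sigma$-algebra, and $\tilde\mu$ is the unique Borel probability measure on $\Sigma_m^\infty$ with $\tilde\mu([i_1\cdots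 i_n])=m^{-n}$ for every finite word $i_1\cdots i_n$. $C\equiv\{1,3\}\pmod 4$ means that the set of residues modulo 4 of the elements of $C$ is $\{1,3\}$ (both residues occur). *)

(* Defs.v *)
From HB Require Import structures.
From mathcomp Require Import all_boot all_order all_algebra.
From mathcomp Require Import complex.
From mathcomp Require Import all_classical all_reals all_analysis.
Import Order.TTheory GRing.Theory Num.Theory.
Import numFieldNormedType.Exports.

Set Implicit Arguments.
Unset Strict Implicit.
Unset Printing Implicit Defensive.

Local Open Scope classical_set_scope.
Local Open Scope ring_scope.
Local Open Scope complex_scope.

Section complex_L2.
Context d (T : measurableType d) (R : realType).
Variable mu : {measure set T -> \bar R}.

(* Meaningful when the real and imaginary parts of f are both integrable. *)
Definition cintegral (f : T -> R[i]) : R[i] :=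
  (\int[mu]_x complex.Re (f x)) +i* (\int[mu]_x complex.Im (f x)).

Definition L2norm (f : T -> R[i]) : \bar R :=
  Lnorm mu 2%:E (fun x => (Normc.normc (f x))%:E).

Definition L2 : set (T -> R[i]) := [set f |
  [/\ measurable_fun setT (fun x => complex.Re (f x)),
      measurable_fun setT (fun x => complex.Im (f x))
    & (L2norm f < +oo)%E]].

Definition L2inner (f g : T -> R[i]) : R[i] :=
  cintegral (fun x => f x * (g x)^*).

(* The family (e i), for i in D, is an orthonormal basis of the Hilbert space
   L^2(mu): it is orthonormal and its linear span is dense.  Elements of L^2
   are represented by functions, not by their classes modulo mu-a.e. equality;
   none of the clauses depends on the choice of representatives. *)
Definition orthonormal_basis (I : eqType) (D : set I) (e : I -> T -> R[i]) :=
  [/\ forall i, D i -> L2 (e i),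
      forall i j, D i -> D j -> L2inner (e i) (e j) = (i == j)%:R
    & forall f, L2 f -> forall eps : R, 0 < eps ->
        exists (s : seq I) (a : I -> R[i]),
          (forall i, i \in s -> D i) /\
          (L2norm (fun x => (f x - \sum_(i <- s) a i * e i x)%R) < eps%:E)%E].

End complex_L2.

Section spectrum.
Context (R : realType).

(* e^(2 pi i lam x) *)
Definition expi (lam x : R) : R[i] :=
  cos (2 * pi * lam * x) +i* sin (2 * pi * lam * x).

Definition is_spectrum (mu : probability (measurableTypeR R) R)
    (Lambda : set R) :=
  Lambda `<=` isolated Lambda /\ orthonormal_basis mu Lambda expi.

Definition tau1 (x : R) : R := 4^-1 * x.
Definition tau2 (x : R) : R := 4^-1 * (x + 2).

(* This invariance determines mu among Borel probability measures on R. *)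
Definition middle_fourth_cantor (mu : probability (measurableTypeR R) R) :=
  forall A : set (measurableTypeR R), measurable A ->
    mu A = ((2^-1)%:E * pushforward mu tau1 A +
            (2^-1)%:E * pushforward mu tau2 A)%E.

End spectrum.

HB.instance Definition _ (n : nat) := isPointed.Build 'I_n.+1 ord0.

(* The letter i_k of an infinite word i_1 i_2 ... is w k.-1. *)
Definition word (m : nat) : Type := nat -> 'I_m.

Definition cylinder (m n : nat) (u : n.-tuple 'I_m) : set (word m) :=
  [set w | forall k : 'I_n, w k = tnth u k].

Definition cylinders (m : nat) : set (set (word m)) :=
  [set A | exists (n : nat) (u : n.-tuple 'I_m), A = cylinder u].

(* The infinite words with the sigma-algebra generated by the cylinder sets.
   The alphabet is 'I_m.+1 because a measurableType must be pointed. *)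
Definition wordspace (m : nat) :=
  g_sigma_algebraType (@cylinders m.+1 : set (set (nat -> 'I_m.+1))).

(* This determines P among probability measures on the space of words. *)
Definition uniform_bernoulli (R : realType) (m : nat)
    (P : probability (wordspace m) R) :=
  forall (n : nat) (u : n.-tuple 'I_m.+1),
    P (cylinder u) = ((m.+1)%:R ^- n)%:E.

Definition Lambda (R : realType) (m : nat) (c : 'I_m -> int) (w : word m) :
    set R :=
  [set x | exists (n : nat) (a : nat -> int),
    [/\ (1 <= n)%N,
        forall k, (k < n)%N -> a k = 0 \/ a k = c (w k)
      & x = (\sum_(k < n) 4 ^+ k * a k)%:~R]].

(* Main.v *)
Require Import Defs.
From mathcomp Require Import all_boot all_order all_algebra.
From mathcomp Require Import complex.
From mathcomp Require Import all_classical all_reals all_analysis.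
From mathcomp Require Import measurable_realfun.
From mathcomp Require Import ring lra zify.
Import Order.TTheory GRing.Theory Num.Theory.
Import numFieldNormedType.Exports.
Import HBNNSimple.

Set Implicit Arguments.
Unset Strict Implicit.
Unset Printing Implicit Defensive.

Local Open Scope classical_set_scope.
Local Open Scope ring_scope.

(** Write phi for the Fourier transform of the Cantor measure mu4, and
    e_t for the exponential of frequency t.  Self-similarity of mu4 reads
    phi(t) = (1 + e_t(1/2)) / 2 * phi(t/4), so that

      |phi(t)|^2 = cos^2(pi t / 2) |phi(t/4)|^2,

    and phi vanishes at 4^k times an odd integer.  Two distinct elements of
    Lambda(w) differ by such a number, because all digits are odd; hence the
    exponentials with frequencies in Lambda(w) are always orthonormal, and only
    completeness is at stake.

    For a finite word u let L(u) be the finite set of sums 4^k a_k with digits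
    prescribed by u.  The squared distance in L^2(mu4) from e_t to the span of
    the exponentials of L(u) is the defect

      h_u(t) = 1 - sum_(x in L(u)) |phi(t - x)|^2 >= 0.

    It decreases when u is extended, and Lambda(w) is a spectrum exactly when
    the defects of the prefixes of w tend to 0 for all t in (1/8)Z: the
    exponentials with these frequencies are total in L^2(mu4), because mu4 lives
    on [-2, 2], where sin(pi x / 4) is monotone, and suitable polynomials in
    this function tend to the indicators of half-lines (lemmas closure_ray,
    closure_L2 and spectrum_Lambda).  This criterion involves countably many
    conditions, each on finitely many letters, which gives measurability.

    Since L(i u) is the disjoint union of 4 L(u) and c_i + 4 L(u), and since
    shifting t by an odd integer exchanges cos^2 and sin^2,

      h_(i u)(t) = cos^2(pi t / 2) h_u(t/4)
                   + sin^2(pi t / 2) h_u((t - c_i)/4).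

    The average H_n(t) of h_u(t) over all words u of length n is therefore the
    n-th iterate of the operator

      (A f)(t) = cos^2(pi t / 2) f(t/4)
                 + sin^2(pi t / 2) mean_i f((t - c_i)/4)

    applied to 1 - |phi|^2.  By Markov's inequality it suffices to show that
    H_n(t) tends to 0 for every t (lemma iter_transfer_cvg0).  The limit H is
    Lipschitz, fixed by A, and H(0) = 0.  Suppose that its maximum M over a
    compact interval stable under t |-> t/4 and t |-> (t - c_i)/4 is positive.
    A convex combination equals M only if every term with positive weight does.
    So if H(t) = M, the points t/4^k cannot all avoid the zeros of
    cos(pi t / 2), since otherwise H(0) = M.  If cos(pi s / 2) = 0 at s = t/4^k,
    then cos(2 pi t) = 1.  Thus every maximum point is an integer, and some
    maximum point s satisfies cos(pi s / 2) = 0, which puts all the points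
    (s - c_i)/4 among the maximum points.  But when c_j - c_i = 2 mod 4, the
    points (s - c_i)/4 and (s - c_j)/4 differ by a half-integer and cannot both
    be integers.  This is where both residues 1 and 3 are used. *)

(** * Complex integration and square distance *)

Section complex_integral.
Context (R : realType).
Local Notation C := R[i].
Local Notation Re := complex.Re.
Local Notation Im := complex.Im.

Lemma cReD (z w : C) : Re (z + w) = Re z + Re w.
Proof. by case: z w => a b [c d]. Qed.
Lemma cImD (z w : C) : Im (z + w) = Im z + Im w.
Proof. by case: z w => a b [c d]. Qed.
Lemma cReN (z : C) : Re (- z) = - Re z. Proof. by case: z. Qed.
Lemma cImN (z : C) : Im (- z) = - Im z. Proof. by case: z. Qed.
Lemma cReM (z w : C) : Re (z * w) = Re z * Re w - Im z * Im w.
Proof. by case: z w => a b [c d]. Qed.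
Lemma cImM (z w : C) : Im (z * w) = Re z * Im w + Im z * Re w.
Proof. by case: z w => a b [c d]. Qed.
Lemma cReJ (z : C) : Re (Num.conj z) = Re z. Proof. by case: z. Qed.
Lemma cImJ (z : C) : Im (Num.conj z) = - Im z. Proof. by case: z. Qed.
Lemma complex_ext (z w : C) : Re z = Re w -> Im z = Im w -> z = w.
Proof. by case: z w => a b [c d] /= -> ->. Qed.

Definition sqn (z : C) : R := Re z ^+ 2 + Im z ^+ 2.

Lemma sqn_ge0 z : 0 <= sqn z. Proof. by rewrite addr_ge0 ?sqr_ge0. Qed.

Lemma sqn_mulJ z : (sqn z)%:C%C = z * Num.conj z.
Proof.
by apply: complex_ext; rewrite ?cReM ?cImM cReJ cImJ /sqn /=; ring.
Qed.

Lemma sqnE z : sqn z = Re (z * Num.conj z).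
Proof. by rewrite -sqn_mulJ. Qed.

Lemma sqnM z w : sqn (z * w) = sqn z * sqn w.
Proof. by rewrite /sqn cReM cImM; ring. Qed.

Lemma sqnD_le z w : sqn (z + w) <= 2 * sqn z + 2 * sqn w.
Proof.
rewrite /sqn cReD cImD -subr_ge0.
have -> : 2 * (Re z ^+ 2 + Im z ^+ 2) + 2 * (Re w ^+ 2 + Im w ^+ 2) -
  ((Re z + Re w) ^+ 2 + (Im z + Im w) ^+ 2) =
  (Re z - Re w) ^+ 2 + (Im z - Im w) ^+ 2 by ring.
by rewrite addr_ge0 ?sqr_ge0.
Qed.

Lemma sqrt_sqn z : Normc.normc z = Num.sqrt (sqn z).
Proof. by case: z. Qed.

Context d (T : measurableType d) (mu : probability T R).

(** Bounded measurable functions are a class stable under products on which all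
    integrals are finite and linear; exponentials belong to it. *)
Definition bmfun (g : T -> R) :=
  measurable_fun setT g /\ exists K, forall x, `|g x| <= K.

Lemma bmfun_integrable g : bmfun g -> mu.-integrable setT (EFin \o g).
Proof.
move=> [mg [K gK]]; apply: measurable_bounded_integrable => //.
  by rewrite (le_lt_trans (probability_le1 _ _))// ltry.
exists K; split; first exact: num_real.
by move=> M KM x _ /=; rewrite (le_trans (gK x))// ltW.
Qed.

Lemma bmfun_cst a : bmfun (fun=> a).
Proof. by split; [exact: measurable_cst|exists `|a|]. Qed.

Lemma bmfunD f g : bmfun f -> bmfun g -> bmfun (fun x => f x + g x).
Proof.
move=> [mf [K fK]] [mg [L gL]]; split; first exact: measurable_funD.
by exists (K + L) => x; rewrite (le_trans (ler_normD _ _))// lerD.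
Qed.

Lemma bmfunM f g : bmfun f -> bmfun g -> bmfun (fun x => f x * g x).
Proof.
move=> [mf [K fK]] [mg [L gL]]; split; first exact: measurable_funM.
by exists (K * L) => x; rewrite normrM ler_pM.
Qed.

Lemma bmfunN f : bmfun f -> bmfun (fun x => - f x).
Proof.
move=> [mf [K fK]]; split; first exact: measurableT_comp.
by exists K => x; rewrite normrN.
Qed.

Definition cmfun (F : T -> C) :=
  measurable_fun setT (fun x => Re (F x)) /\
  measurable_fun setT (fun x => Im (F x)).

Definition cbmfun (F : T -> C) :=
  bmfun (fun x => Re (F x)) /\ bmfun (fun x => Im (F x)).

Lemma cbmfun_cmfun F : cbmfun F -> cmfun F.
Proof. by move=> [[? _] [? _]]. Qed.

Lemma eq_bmfun f g : f =1 g -> bmfun f -> bmfun g.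
Proof. by move=> /funext ->. Qed.

Lemma cbmfun_cst a : cbmfun (fun=> a).
Proof. by split; exact: bmfun_cst. Qed.

Lemma cbmfunD F G : cbmfun F -> cbmfun G -> cbmfun (fun x => F x + G x).
Proof.
move=> [F1 F2] [G1 G2]; split.
  by apply: eq_bmfun (bmfunD F1 G1) => x; rewrite cReD.
by apply: eq_bmfun (bmfunD F2 G2) => x; rewrite cImD.
Qed.

Lemma cbmfunM F G : cbmfun F -> cbmfun G -> cbmfun (fun x => F x * G x).
Proof.
move=> [F1 F2] [G1 G2]; split.
  apply: eq_bmfun (bmfunD (bmfunM F1 G1) (bmfunN (bmfunM F2 G2))) => x.
  by rewrite cReM.
by apply: eq_bmfun (bmfunD (bmfunM F1 G2) (bmfunM F2 G1)) => x; rewrite cImM.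
Qed.

Lemma cbmfun_sum I (s : seq I) (F : I -> T -> C) :
  (forall i, cbmfun (F i)) -> cbmfun (fun x => \sum_(i <- s) F i x).
Proof.
move=> mF; elim: s => [|i s IH].
  rewrite (_ : (fun _ => _) = fun=> 0); first exact: cbmfun_cst.
  by apply/funext => x; rewrite big_nil.
rewrite (_ : (fun _ => _) = fun x => F i x + \sum_(j <- s) F j x).
  exact: cbmfunD.
by apply/funext => x; rewrite big_cons.
Qed.

Lemma cmfun_cst a : cmfun (fun=> a).
Proof. by split; exact: measurable_cst. Qed.

Lemma cmfunD F G : cmfun F -> cmfun G -> cmfun (fun x => F x + G x).
Proof.
move=> [F1 F2] [G1 G2]; split.
  by under eq_fun do rewrite cReD; exact: measurable_funD.
by under eq_fun do rewrite cImD; exact: measurable_funD.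
Qed.

Lemma cmfunM F G : cmfun F -> cmfun G -> cmfun (fun x => F x * G x).
Proof.
move=> [F1 F2] [G1 G2]; split.
  by under eq_fun do rewrite cReM; apply: measurable_funB; exact: measurable_funM.
by under eq_fun do rewrite cImM; apply: measurable_funD; exact: measurable_funM.
Qed.

Lemma cmfunB F G : cmfun F -> cmfun G -> cmfun (fun x => F x - G x).
Proof.
move=> mF mG; rewrite (_ : (fun _ => _) = fun x => F x + (-1) * G x).
  exact/cmfunD/cmfunM/mG/cmfun_cst.
by apply/funext => x; rewrite mulN1r.
Qed.

Lemma cintegralD F G : cbmfun F -> cbmfun G ->
  cintegral mu (fun x => F x + G x) = cintegral mu F + cintegral mu G.
Proof.
move=> [F1 F2] [G1 G2]; rewrite /cintegral.
under [in X in (X +i* _)%C]eq_Rintegral do rewrite cReD.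
under [in X in (_ +i* X)%C]eq_Rintegral do rewrite cImD.
by rewrite !RintegralD//; exact: bmfun_integrable.
Qed.

Lemma cintegralZ a F : cbmfun F ->
  cintegral mu (fun x => a * F x) = a * cintegral mu F.
Proof.
move=> [F1 F2]; rewrite /cintegral.
under [in X in (X +i* _)%C]eq_Rintegral do rewrite cReM.
under [in X in (_ +i* X)%C]eq_Rintegral do rewrite cImM.
have h b f : bmfun f -> mu.-integrable setT (EFin \o (fun x => b * f x)).
  by move=> mf; apply/bmfun_integrable/bmfunM => //; exact: bmfun_cst.
rewrite RintegralB ?RintegralD//; try exact: h.
rewrite !RintegralZl//; try exact: bmfun_integrable.
by apply: complex_ext; rewrite ?cReM ?cImM.
Qed.

Lemma Rintegral_probability_cst (r : R) : \int[mu]_x r = r.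
Proof.
rewrite Rintegral_cst//.
have -> : (mu : {measure set T -> \bar R}) setT = 1%E by exact: probability_setT.
by rewrite mulr1.
Qed.

Lemma cintegral_cst a : cintegral mu (fun=> a) = a.
Proof.
by rewrite /cintegral !Rintegral_probability_cst; case: a.
Qed.

Lemma cintegral_sum I (s : seq I) (F : I -> T -> C) :
  (forall i, cbmfun (F i)) ->
  cintegral mu (fun x => \sum_(i <- s) F i x) = \sum_(i <- s) cintegral mu (F i).
Proof.
move=> mF; elim: s => [|i s IH].
  rewrite big_nil (_ : (fun _ => _) = fun=> 0) ?cintegral_cst//.
  by apply/funext => x; rewrite big_nil.
rewrite big_cons -IH -cintegralD//; last exact: cbmfun_sum.
by congr cintegral; apply/funext => x; rewrite big_cons.
Qed.

(** The square of the L^2 norm.  It is kept in the extended reals so that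
    functions outside L^2 may be compared to trigonometric polynomials before
    they are known to be square integrable. *)
Definition energy (F : T -> C) : \bar R := (\int[mu]_x (sqn (F x))%:E)%E.

Lemma measurable_sqn F : cmfun F -> measurable_fun setT (fun x => sqn (F x)).
Proof. by move=> [? ?]; apply: measurable_funD; exact: measurable_funX. Qed.

Lemma energy_ge0 F : (0 <= energy F)%E.
Proof. by apply: integral_ge0 => x _; rewrite lee_fin sqn_ge0. Qed.

Lemma L2normE F : L2norm mu F = sqrte (energy F).
Proof.
rewrite /L2norm unlock poweR12_sqrt; last first.
  by apply: integral_ge0 => x _; exact: poweR_ge0.
congr sqrte; apply: eq_integral => x _.
rewrite abse_EFin poweR_EFin powR_mulrn// ger0_norm; last first.
  by rewrite sqrt_sqn sqrtr_ge0.
by rewrite sqrt_sqn sqr_sqrtr// sqn_ge0.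
Qed.

Lemma L2norm_lty F : (L2norm mu F < +oo)%E = (energy F < +oo)%E.
Proof.
rewrite L2normE; have := energy_ge0 F; case: (energy F) => //= r _.
by rewrite !ltry.
Qed.

(** Approximation in L^2 norm is traded for approximation in energy, which is an
    honest integral. *)
Lemma L2norm_lt F e : 0 < e ->
  (L2norm mu F < e%:E)%E = (energy F < (e ^+ 2)%:E)%E.
Proof.
move=> e0; rewrite L2normE; have := energy_ge0 F; case: (energy F) => //=.
  move=> r; rewrite !lte_fin lee_fin => r0.
  by rewrite -[in LHS](ger0_norm (ltW e0)) -sqrtr_sqr ltr_sqrt// exprn_gt0.
Qed.

(** This weak triangle inequality, which follows from |z + w|^2 <= 2|z|^2 +
    2|w|^2, is enough for all density arguments. *)
Lemma energyD_le F G : cmfun F -> cmfun G ->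
  (energy (fun x => F x + G x)%R <= 2%:E * energy F + 2%:E * energy G)%E.
Proof.
move=> mF mG; rewrite /energy -!ge0_integralZl//; first last.
- by move=> x _; rewrite lee_fin sqn_ge0.
- exact/measurable_EFinP/measurable_sqn.
- by move=> x _; rewrite lee_fin sqn_ge0.
- exact/measurable_EFinP/measurable_sqn.
rewrite -ge0_integralD//; first last.
- exact/measurable_funeM/measurable_EFinP/measurable_sqn.
- by move=> x _; rewrite -EFinM lee_fin mulr_ge0// sqn_ge0.
- exact/measurable_funeM/measurable_EFinP/measurable_sqn.
- by move=> x _; rewrite -EFinM lee_fin mulr_ge0// sqn_ge0.
apply: ge0_le_integral => //.
- by move=> x _; rewrite lee_fin sqn_ge0.
- exact/measurable_EFinP/measurable_sqn/cmfunD.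
- by apply: emeasurable_funD; exact/measurable_funeM/measurable_EFinP/measurable_sqn.
- by move=> x _; rewrite -!EFinM -EFinD lee_fin sqnD_le.
Qed.

Lemma energyZ a F : cmfun F ->
  energy (fun x => a * F x) = ((sqn a)%:E * energy F)%E.
Proof.
move=> mF; rewrite /energy -ge0_integralZl//; first last.
- by rewrite lee_fin sqn_ge0.
- by move=> x _; rewrite lee_fin sqn_ge0.
- exact/measurable_EFinP/measurable_sqn.
by apply: eq_integral => x _; rewrite sqnM.
Qed.

Lemma energyE F : cbmfun F ->
  energy F = (Re (cintegral mu (fun x => F x * (F x)^*)))%:E.
Proof.
move=> mF; rewrite /cintegral/= /energy.
under [in RHS]eq_Rintegral do rewrite -sqnE.
rewrite fineK//; apply: integrable_fin_num => //; apply: bmfun_integrable.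
by apply: bmfunD; apply: bmfunM; case: mF.
Qed.

Lemma energy_lty F : cbmfun F -> (energy F < +oo)%E.
Proof. by move=> /energyE ->; rewrite ltry. Qed.

Lemma L2_cbmfun F : cbmfun F -> L2 mu F.
Proof.
move=> bF; have [mRe mIm] := cbmfun_cmfun bF; split => //.
by rewrite L2norm_lty energy_lty.
Qed.

End complex_integral.

(** * Exponentials and the Pythagoras identity *)

Section exponentials.
Context (R : realType).
Local Notation C := R[i].
Local Notation Re := complex.Re.
Local Notation Im := complex.Im.

Lemma expiD (s t x : R) : expi (s + t) x = expi s x * expi t x.
Proof.
apply: complex_ext; rewrite ?cReM ?cImM /= (_ : 2 * pi * (s + t) * x =
  2 * pi * s * x + 2 * pi * t * x) ?cosD ?sinD; ring.
Qed.

Lemma expi0 (x : R) : expi 0 x = 1 :> C.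
Proof. by apply: complex_ext; rewrite /expi mulr0 mul0r/= ?cos0 ?sin0. Qed.

Lemma expiJ (t x : R) : (expi t x)^* = expi (- t) x.
Proof. by apply: complex_ext; rewrite /= mulrN mulNr ?cosN ?sinN. Qed.

Lemma expi_sym (t x : R) : expi t x = expi x t.
Proof. by rewrite /expi -!mulrA (mulrC t). Qed.

Lemma expi_int (z : int) : expi z%:~R 1 = 1 :> C.
Proof.
have expi1 : expi 1 1 = 1 :> C.
  apply: complex_ext; rewrite /= !mulr1 mulrC mulr_natr ?cos2pi ?sin2pi//.
have expin (k : nat) : expi k%:R 1 = 1 :> C.
  elim: k => [|k IH]; first exact: expi0.
  by rewrite -natr1 expiD IH expi1 mulr1.
case: (intP z) => [|k|k]; rewrite ?expi0//; first exact: (expin k.+1).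
by rewrite mulrNz -expiJ expin rmorph1.
Qed.

Lemma cbmfun_expi (t : R) : @cbmfun R _ (measurableTypeR R) (expi t).
Proof.
have c (f : R -> R) : continuous f -> continuous (fun x : R => f (2 * pi * t * x)).
  move=> cf x; apply: (@continuous_comp _ _ _ (fun x => 2 * pi * t * x) f).
    by apply: cvgM; [exact: cvg_cst|exact: cvg_id].
  exact: cf.
split; split.
- by apply: continuous_measurable_fun; apply: (c cos); exact: continuous_cos.
- by exists 1 => x; exact: cos_max.
- by apply: continuous_measurable_fun; apply: (c sin); exact: continuous_sin.
- by exists 1 => x; exact: sin_max.
Qed.

(** Trigonometric polynomials are lists of pairs (frequency, coefficient) with
    repetitions allowed, so that sums and products of polynomials are
    concatenations and products of lists. *)
Definition trig (l : seq (R * C)) (x : R) : C :=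
  \sum_(p <- l) p.2 * expi p.1 x.

Lemma cbmfun_trig l : @cbmfun R _ (measurableTypeR R) (trig l).
Proof.
by apply: cbmfun_sum => p; apply: cbmfunM; [exact: cbmfun_cst|exact: cbmfun_expi].
Qed.

(** Grouping equal frequencies turns a list of terms into a coefficient function
    on distinct frequencies, for which orthogonality can be used. *)
Lemma trig_uniq (l : seq (R * C)) : exists (s : seq R) (a : R -> C),
  [/\ uniq s, {subset s <= [seq p.1 | p <- l]} &
      forall x, trig l x = \sum_(i <- s) a i * expi i x].
Proof.
exists (undup [seq p.1 | p <- l]), (fun i => \sum_(p <- l | p.1 == i) p.2).
split; [exact: undup_uniq|by move=> i; rewrite mem_undup|].
move=> x; under eq_bigr do rewrite mulr_suml big_mkcond.
rewrite exchange_big/= /trig; apply: eq_big_seq => p pl.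
rewrite (bigD1_seq p.1) ?undup_uniq ?mem_undup ?map_f//= eqxx big1 ?addr0// => i.
by rewrite eq_sym => /negbTE ->.
Qed.

Variable mu : probability (measurableTypeR R) R.

Definition fourier (t : R) : C := cintegral mu (expi t).

Lemma fourier0 : fourier 0 = 1.
Proof.
rewrite /fourier (_ : expi 0 = fun=> 1) ?cintegral_cst//.
by apply/funext => x; rewrite expi0.
Qed.

Lemma fourierN t : fourier (- t) = (fourier t)^*.
Proof.
rewrite /fourier /cintegral/=; congr (_ +i* _)%C.
  by apply: eq_Rintegral => x _; rewrite mulrN mulNr cosN.
have [_ mF] := cbmfun_expi t.
transitivity (\int[mu]_x (-1 * Im (expi t x)) : R).
  by apply: eq_Rintegral => x _; rewrite mulN1r -cImJ expiJ.
by rewrite RintegralZl ?mulN1r//; exact: bmfun_integrable.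
Qed.

Lemma L2inner_expi s t : L2inner mu (expi s) (expi t) = fourier (s - t).
Proof.
by congr cintegral; apply/funext => x; rewrite expiJ -expiD.
Qed.

Lemma L2inner_trig l l' : L2inner mu (trig l) (trig l') =
  \sum_(p <- l) \sum_(q <- l') p.2 * (q.2^* * fourier (p.1 - q.1)).
Proof.
have mE a t : @cbmfun R _ (measurableTypeR R) (fun x => a * expi t x).
  by apply: cbmfunM; [exact: cbmfun_cst|exact: cbmfun_expi].
transitivity (cintegral mu (fun x => \sum_(p <- l) p.2 *
    \sum_(q <- l') q.2^* * expi (p.1 - q.1) x)).
  congr cintegral; apply/funext => x.
  rewrite /trig mulr_suml; apply: eq_bigr => p _; rewrite -mulrA; congr (_ * _).
  rewrite rmorph_sum mulr_sumr; apply: eq_bigr => q _.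
  by rewrite rmorphM/= expiJ expiD mulrCA.
rewrite cintegral_sum => [|p]; last first.
  by apply: cbmfunM; [exact: cbmfun_cst|exact: cbmfun_sum].
apply: eq_bigr => p _; rewrite cintegralZ; last exact: cbmfun_sum.
rewrite cintegral_sum// mulr_sumr; apply: eq_bigr => q _; congr (_ * _).
by rewrite cintegralZ//; exact: cbmfun_expi.
Qed.

Lemma energy_trig l :
  energy mu (trig l) = (Re (L2inner mu (trig l) (trig l)))%:E.
Proof. exact/energyE/cbmfun_trig. Qed.

(** Expansion of the squared distance from e_t to an arbitrary combination of
    orthonormal exponentials.  The choice a_i = phi(t - i) gives the defect; for
    any other choice the last sum is nonnegative, so no combination does
    better. *)
Lemma pythagoras (t : R) (s : seq R) (a : R -> C) :
  uniq s -> {in s &, forall i j, i != j -> fourier (i - j) = 0} ->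
  energy mu (fun x => expi t x - \sum_(i <- s) a i * expi i x) =
  (1 - \sum_(i <- s) sqn (fourier (t - i)) +
   \sum_(i <- s) sqn (a i - fourier (t - i)))%:E.
Proof.
move=> us os; pose l := (t, 1 : C) :: [seq (i, - a i) | i <- s].
rewrite (_ : (fun _ => _) = trig l); last first.
  apply/funext => x; rewrite /trig big_cons mul1r big_map/= -sumrN.
  by congr (_ + _); apply: eq_bigr => i _; rewrite mulNr.
rewrite energy_trig L2inner_trig big_cons big_map/= big_cons big_map/=.
rewrite subrr fourier0 mul1r rmorph1 mulr1.
rewrite [X in _ + X](eq_big_seq
  (fun i => - (a i * (fourier (t - i))^*) + a i * (a i)^*)); last first.
  move=> i si /=; rewrite big_cons big_map/= rmorph1 mul1r -fourierN opprB.
  rewrite mulNr; congr (_ + _); rewrite (bigD1_seq i)//= subrr fourier0 big_seq_cond.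
  rewrite big1 ?addr0 ?mulr1 => [|j /andP[sj ji]].
    by rewrite rmorphN mulrNN.
  by rewrite os// 1?eq_sym// mulr0 mulr0.
congr EFin; rewrite !cReD !raddf_sum /= -!addrA; congr (1 + _).
rewrite -!big_split/=; apply: eq_bigr => i _.
have -> : (- a i)^* = - (a i)^* by exact: rmorphN.
rewrite mul1r mulNr /sqn.
rewrite !(cReD, cImD, cReN, cImN, cReM, cReJ, cImJ). ring.
Qed.
End exponentials.

(** * Periodicity of the exponentials in their frequency *)

Section cos_shift.
Context (R : realType).
Local Notation C := R[i].
Local Notation Re := complex.Re.

Lemma expi_half : expi 2^-1 1 = -1 :> C.
Proof.
have E : 2 * pi / 2 * 1 = pi :> R by field.
by apply: complex_ext; rewrite /= E ?cospi ?sinpi ?oppr0.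
Qed.

Lemma cos_expi (t : R) : cos (pi * t / 2) = Re (expi (t / 4) 1).
Proof. by congr cos; field. Qed.

Lemma cos_sqr_expi (t : R) : cos (pi * t / 2) ^+ 2 = (1 + Re (expi (t / 2) 1)) / 2.
Proof.
have -> : Re (expi (t / 2) 1) = cos ((pi * t / 2) *+ 2).
  by congr cos; rewrite -mulr_natl; field.
by rewrite cos_mulr2n; field.
Qed.

Lemma expi_period (s : R) (z : int) : expi (s + z%:~R) 1 = expi s 1 :> C.
Proof. by rewrite expiD expi_int mulr1. Qed.

Lemma expi_antiperiod (s : R) (z : int) : expi (s + 2^-1 + z%:~R) 1 = - expi s 1 :> C.
Proof. by rewrite expi_period expiD expi_half mulrN1. Qed.

Lemma cos_sqr_even (t : R) (z : int) :
  cos (pi * (t - (4 * z)%:~R) / 2) ^+ 2 = cos (pi * t / 2) ^+ 2.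
Proof.
rewrite !cos_sqr_expi -(expi_period (t / 2) (- (2 * z))).
do 4 f_equal; rewrite !(intrM, rmorphN)/=; by field.
Qed.

(** A shift of t by an odd integer moves t/2 by a half-integer, so that it
    changes the sign of cos(pi t) and exchanges cos^2 and sin^2 at pi t / 2. *)
Lemma cos_sqr_odd (t : R) (q z : int) :
  cos (pi * (t - (2 * q + 1 + 4 * z)%:~R) / 2) ^+ 2 = sin (pi * t / 2) ^+ 2.
Proof.
rewrite sin2cos2 !cos_sqr_expi.
have -> : (t - (2 * q + 1 + 4 * z)%:~R) / 2 = t / 2 + 2^-1 + (- (q + 1 + 2 * z))%:~R.
  by rewrite !(intrD, intrM, rmorphN)/=; field.
by rewrite expi_antiperiod cReN; field.
Qed.

(** If b - a = 2 mod 4, then (t - a)/4 and (t - b)/4 differ by a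
    half-integer. *)
Lemma cos_antiperiod (t : R) (a b z : int) : b = a + 2 + 4 * z ->
  cos (pi * (t - b%:~R) / 2) = - cos (pi * (t - a%:~R) / 2).
Proof.
move=> ->; rewrite !cos_expi -cReN -(expi_antiperiod _ (- (1 + z))).
do 3 f_equal; rewrite !(intrD, intrM, rmorphN)/=; by field.
Qed.
End cos_shift.

(** * Iterates of the transfer operator tend to zero *)

Section transfer.
Context (R : realType).

Lemma cos_dist (x y : R) : `|cos x - cos y| <= `|x - y|.
Proof.
wlog xy : x y / x <= y.
  by move=> H; case: (leP x y) => [|/ltW] /H //; rewrite distrC (distrC y).
have [z _ E] : exists2 z, z \in `[x, y] & cos y - cos x = - sin z * (y - x).
  apply: MVT_segment => //; apply: continuous_subspaceT; exact: continuous_cos.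
rewrite distrC E (distrC x) normrM normrN ler_piMl ?normr_ge0 ?sin_max//.
Qed.

Lemma sin_dist (x y : R) : `|sin x - sin y| <= `|x - y|.
Proof.
rewrite -!cosBpihalf (le_trans (cos_dist _ _))// le_eqVlt; apply/orP; left.
by apply/eqP; congr Num.norm; ring.
Qed.

Lemma cos4_eq1 (x : R) : cos x = 0 \/ cos x = 1 -> cos (4 * x) = 1.
Proof.
have -> : 4 * x = (x *+ 2) *+ 2 by rewrite -mulrnA -[RHS]mulr_natl.
by rewrite !cos_mulr2n => -[] ->; ring.
Qed.

(** If x is an odd multiple of pi/2, then 4x, and hence 4^(k+1) x, is a multiple
    of 2 pi. *)
Lemma cos_eq0_pow4 k (x : R) : cos x = 0 -> cos (4 ^+ k.+1 * x) = 1.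
Proof.
move=> x0; elim: k => [|k IH]; first by rewrite expr1 cos4_eq1//; left.
by rewrite exprS -mulrA cos4_eq1//; right.
Qed.

Definition mean n (a : 'I_n.+1 -> R) := (\sum_i a i) / n.+1%:R.

Lemma ler_mean n (a b : 'I_n.+1 -> R) :
  (forall i, a i <= b i) -> mean a <= mean b.
Proof. by move=> ab; rewrite ler_pM2r ?invr_gt0 ?ltr0n// ler_sum. Qed.

Lemma mean_cst n (x : R) : mean (fun _ : 'I_n.+1 => x) = x.
Proof. by rewrite /mean sumr_const card_ord -[x *+ _]mulr_natr mulfK// pnatr_eq0. Qed.

Lemma mean_eq_max n (a : 'I_n.+1 -> R) x :
  (forall i, a i <= x) -> x <= mean a -> forall i, a i = x.
Proof.
move=> ax xa i; apply/eqP; rewrite eq_le ax /= leNgt; apply/negP => aix.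
move: xa; rewrite leNgt => /negP; apply.
rewrite -[ltRHS](mean_cst n) /mean ltr_pM2r ?invr_gt0 ?ltr0n//.
rewrite (bigD1 i)//= [ltRHS](bigD1 i)//=; apply: ltr_leD => //.
by apply: ler_sum.
Qed.

Lemma mean_dist n (a b : 'I_n.+1 -> R) e :
  (forall i, `|a i - b i| <= e) -> `|mean a - mean b| <= e.
Proof.
move=> abe; rewrite /mean -mulrBl -sumrB normrM.
rewrite [X in _ * X]ger0_norm ?invr_ge0 ?ler0n//.
rewrite -[leRHS](mean_cst n) /mean ler_pM2r ?invr_gt0 ?ltr0n//.
by rewrite (le_trans (ler_norm_sum _ _ _))// ler_sum.
Qed.

Variables (n : nat) (c : 'I_n.+1 -> R).

Definition transfer (f : R -> R) (t : R) : R :=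
  cos (pi * t / 2) ^+ 2 * f (t / 4) +
  sin (pi * t / 2) ^+ 2 * mean (fun i => f ((t - c i) / 4)).

Lemma transfer_le f g : (forall t, f t <= g t) ->
  forall t, transfer f t <= transfer g t.
Proof.
move=> fg t; apply: lerD; apply: ler_wpM2l => //; rewrite ?sqr_ge0//.
exact: ler_mean.
Qed.

Lemma transfer_cst x t : transfer (fun=> x) t = x.
Proof. by rewrite /transfer mean_cst -mulrDl cos2Dsin2 mul1r. Qed.

(** The arguments t/4 and (t - c_i)/4 divide the Lipschitz constant by 4, and
    the weights contribute at most pi; the constant K reproduces itself because
    pi + K/4 <= K. *)
Lemma transfer_lipschitz K f : 2 * pi <= K ->
  (forall t, 0 <= f t <= 1) ->
  (forall s t, `|f s - f t| <= K * `|s - t|) ->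
  forall s t, `|transfer f s - transfer f t| <= K * `|s - t|.
Proof.
move=> piK f01 fK s t; rewrite /transfer.
set a := fun t => f (t / 4); set b := fun t => mean (fun i => f ((t - c i) / 4)).
have b01 u : 0 <= b u <= 1.
  rewrite -{1}(mean_cst n 0) -(mean_cst n 1).
  by apply/andP; split; apply: ler_mean => i; have /andP[] := f01 ((u - c i) / 4).
have aK : `|a s - a t| <= K / 4 * `|s - t|.
  rewrite (le_trans (fK _ _))// -mulrBl normrM [`|4^-1|]ger0_norm//; lra.
have bK : `|b s - b t| <= K / 4 * `|s - t|.
  apply: mean_dist => i; rewrite (le_trans (fK _ _))// -mulrBl normrM.
  rewrite [`|4^-1|]ger0_norm// opprB addrA subrK; lra.
have abs : `|a s - b s| <= 1.
  have := b01 s; have := f01 (s / 4); rewrite -/(a s) ler_norml; lra.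
set C := cos (pi * s / 2); set D := cos (pi * t / 2).
have CD : `|C ^+ 2 - D ^+ 2| <= pi * `|s - t|.
  rewrite subr_sqr normrM mulrC.
  have -> : pi * `|s - t| = 2 * `|pi * s / 2 - pi * t / 2|.
    rewrite -mulrBl -mulrBr !normrM (ger0_norm (pi_ge0 R)) [`|2^-1|]ger0_norm//; lra.
  apply: ler_pM => //; last exact: cos_dist.
  rewrite (le_trans (ler_normD _ _))//.
  by have := cos_max (pi * s / 2); have := cos_max (pi * t / 2); rewrite -/C -/D; lra.
rewrite !sin2cos2 -/C -/D -/(a s) -/(a t) -/(b s) -/(b t).
have -> : C ^+ 2 * a s + (1 - C ^+ 2) * b s - (D ^+ 2 * a t + (1 - D ^+ 2) * b t)
  = (C ^+ 2 - D ^+ 2) * (a s - b s) +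
    (D ^+ 2 * (a s - a t) + (1 - D ^+ 2) * (b s - b t)) by ring.
have D2 : 0 <= D ^+ 2 <= 1 
  by rewrite sqr_ge0 -[D ^+ 2]ger0_norm ?sqr_ge0// normrX exprn_ile1 ?cos_max.
apply: (@le_trans _ _ (pi * `|s - t| * 1 + (D ^+ 2 * (K / 4 * `|s - t|) +
    (1 - D ^+ 2) * (K / 4 * `|s - t|)))).
  rewrite (le_trans (ler_normD _ _))// lerD//.
    by rewrite normrM ler_pM.
  rewrite (le_trans (ler_normD _ _))// lerD// normrM ger0_norm; try lra;
    rewrite ler_wpM2l//; lra.
rewrite -mulrDl subrKC mul1r mulr1 -mulrDl ler_wpM2r//; have := pi_gt0 R; lra.
Qed.

Section limit.
Variables (f0 : R -> R) (K : R).
Hypothesis piK : 2 * pi <= K.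
Hypothesis f0_01 : forall t, 0 <= f0 t <= 1.
Hypothesis f0K : forall s t, `|f0 s - f0 t| <= K * `|s - t|.
Hypothesis f0_transfer : forall t, transfer f0 t <= f0 t.
Hypothesis f0_0 : f0 0 = 0.

Let f k := iter k transfer f0.

Lemma iter_transfer_01 k t : 0 <= f k t <= 1.
Proof.
elim: k t => [|k IH] t; first exact: f0_01.
rewrite -{1}(transfer_cst 0 t) -(transfer_cst 1 t) /f iterS.
by apply/andP; split; apply: transfer_le => u; have /andP[] := IH u.
Qed.

Lemma iter_transfer_lipschitz k s t : `|f k s - f k t| <= K * `|s - t|.
Proof.
elim: k s t => [|k IH] s t; first exact: f0K.
by apply: transfer_lipschitz => // u; exact: iter_transfer_01.
Qed.

Lemma iter_transfer_noninc t : nonincreasing_seq (f ^~ t).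
Proof.
apply/nonincreasing_seqP => k; elim: k t => [|k IH] t; first exact: f0_transfer.
exact: transfer_le.
Qed.

Let H t := lim (f k t @[k --> \oo]).

Let cvgH t : f k t @[k --> \oo] --> H t.
Proof.
apply: nonincreasing_is_cvgn; first exact: iter_transfer_noninc.
by exists 0 => _ [k _ <-]; have /andP[] := iter_transfer_01 k t.
Qed.

Let H01 t : 0 <= H t <= 1.
Proof.
apply/andP; split; [apply: limr_ge|apply: limr_le];
  by [apply: cvgP; exact: cvgH|near=> k; have /andP[] := iter_transfer_01 k t].
Unshelve. all: by end_near. Qed.

Let H0 : H 0 = 0.
Proof.
apply/le_anti/andP; split; last by have /andP[] := H01 0.
apply: limr_le; first by apply: cvgP; exact: cvgH.
by apply: nearW => k; rewrite -[leRHS]f0_0; exact: (iter_transfer_noninc 0 (leq0n k)).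
Qed.

Let HK s t : `|H s - H t| <= K * `|s - t|.
Proof.
have h : `|f k s - f k t| @[k --> \oo] --> `|H s - H t|.
  by apply: cvg_norm; apply: cvgB; exact: cvgH.
rewrite -(cvg_lim _ h)//; apply: limr_le; first by apply: cvgP; exact: h.
by near=> k; exact: iter_transfer_lipschitz.
Unshelve. all: by end_near. Qed.

Let H_transfer t : H t = transfer H t.
Proof.
have h : f k.+1 t @[k --> \oo] --> transfer H t.
  apply: cvgD; apply: cvgM; [exact: cvg_cst|exact: cvgH|exact: cvg_cst|].
  apply: cvgM; last exact: cvg_cst.
  apply: cvg_big => [|i _]; [exact: add_continuous|exact: cvgH].
have h' : f^~ t @ \oo --> H t by exact: cvgH.
move: h'; rewrite -(cvg_shiftS (f^~ t)) => h'.
by apply: (cvg_unique _ h' h).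
Qed.

Let continuousH : continuous H.
Proof.
move=> t; apply/cvgrPdist_le => e e0.
have K0 : 0 < K by rewrite (lt_le_trans _ piK)// mulr_gt0// pi_gt0.
near=> s; rewrite (le_trans (HK _ _))// mulrC -ler_pdivlMr//.
near: s; apply: cvgr_dist_le; [exact: cvg_id|exact: divr_gt0].
Unshelve. all: by end_near. Qed.

Variables i j : 'I_n.+1.
Hypothesis c_ij : forall t,
  cos (pi * (t - c j) / 2) = - cos (pi * (t - c i) / 2).

(** The maximum principle explained at the top: a positive maximum of the limit
    H would be attained both at (s - c_i)/4 and at (s - c_j)/4 for some s, and
    these two points would have to be integers. *)
Lemma iter_transfer_cvg0 t : f k t @[k --> \oo] --> 0.
Proof.
suff -> : 0 = H t by exact: cvgH.
apply/eqP/negP => /negP Ht0; have {Ht0} Ht_gt0 : 0 < H t.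
  by rewrite lt_def eq_sym Ht0; have /andP[] := H01 t.
pose r : R := `|t| + \sum_i `|c i|.
(* [-r, r] contains t and is mapped into itself by u |-> u/4 and
   u |-> (u - c_l)/4. *)
have c_r l : `|c l| <= r.
  rewrite /r (bigD1 l)//= addrCA ler_wpDr// addr_ge0//.
  by apply: sumr_ge0.
have r0 : 0 <= r by rewrite (le_trans _ (c_r ord0)).
have [|s0 s0I s0max] := @EVT_max _ H (- r) r (ge0_cp r0).2.
  by apply: continuous_subspaceT; exact: continuousH.
set M := H s0 in s0max.
pose I := fun u : R => `|u| <= r.
have HM u : I u -> H u <= M by move=> Iu; apply: s0max; rewrite in_itv/= -ler_norml.
have M0 : 0 < M.
  by rewrite (lt_le_trans Ht_gt0)// HM// /I /r lerDl sumr_ge0.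
have I4 u : I u -> I (u / 4).
  by rewrite /I normrM [`|4^-1|]ger0_norm//; have := normr_ge0 u; lra.
have Ic u l : I u -> I ((u - c l) / 4).
  rewrite /I normrM [`|4^-1|]ger0_norm// => ur.
  have := c_r l; have := ler_normB u (c l); lra.
have meanM u : I u -> mean (fun l => H ((u - c l) / 4)) <= M.
  by move=> Iu; rewrite -[leRHS](mean_cst n); apply: ler_mean => l; exact/HM/Ic.
have H4 u : I u -> H u = M -> cos (pi * u / 2) != 0 -> H (u / 4) = M.
  move=> Iu HuM cu; apply/le_anti; rewrite HM ?I4//=.
  have cu2 : 0 < cos (pi * u / 2) ^+ 2 by rewrite exprn_even_gt0.
  rewrite -(ler_pM2l cu2) -(lerD2r (sin (pi * u / 2) ^+ 2 * M)).
  rewrite -mulrDl cos2Dsin2 mul1r -[leLHS]HuM H_transfer /transfer lerD2l.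
  by rewrite ler_wpM2l ?sqr_ge0// meanM.
have Hc u l : I u -> H u = M -> cos (pi * u / 2) = 0 -> H ((u - c l) / 4) = M.
  move=> Iu HuM cu; move: l; apply: mean_eq_max => [l|]; first exact/HM/Ic.
  by rewrite -[leLHS]HuM H_transfer /transfer sin2cos2 cu expr0n/= mul0r add0r subr0 mul1r.
have I4k u k : I u -> I (u / 4 ^+ k).
  by move=> Iu; elim: k => [|k IH]; rewrite ?expr0 ?divr1// exprSr invfM mulrA I4.
(* Otherwise H = M along the sequence u / 4^k, which tends to 0 where H = 0. *)
have zero u : I u -> H u = M ->
    exists k, H (u / 4 ^+ k) = M /\ cos (pi * (u / 4 ^+ k) / 2) = 0.
  move=> Iu HuM; apply: contrapT => nex.
  have HkM k : H (u / 4 ^+ k) = M.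
    elim: k => [|k IH]; first by rewrite expr0 divr1.
    rewrite exprSr invfM mulrA; apply: H4 => //; first exact: I4k.
    by apply/eqP => ck; apply: nex; exists k.
  have K0 : 0 <= K by rewrite (le_trans _ piK)// mulr_ge0// pi_ge0.
  have x0 : 0 <= K * `|u| / M by rewrite divr_ge0 ?mulr_ge0// ltW.
  have := archi_boundP x0; set N := Num.Def.archi_bound _ => xN.
  have := HK (u / 4 ^+ N) 0; rewrite HkM H0 !subr0 normrM.
  rewrite (gtr0_norm M0) [`|_^-1|]ger0_norm ?invr_ge0 ?exprn_ge0// mulrA.
  rewrite ler_pdivlMr ?exprn_gt0// leNgt => /negP; apply.
  rewrite -ltr_pdivrMl// mulrC (lt_le_trans xN)// -natrX ler_nat ltnW//.
  exact: ltn_expl.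
(* Maximum points are integers. *)
have cos1 u : I u -> H u = M -> cos (2 * (pi * u)) = 1.
  move=> Iu HuM; have [k [_ /(cos_eq0_pow4 k)]] := zero u Iu HuM.
  move=> E; rewrite -[RHS]E; congr cos; rewrite exprS.
  have : (4 : R) ^+ k != 0 by rewrite expf_neq0.
  by move: (4 ^+ k) => q q0; field.
have Is0 : I s0 by move: s0I; rewrite in_itv/= -ler_norml.
have [k [HsM cs]] := zero s0 Is0 erefl.
set s := s0 / 4 ^+ k in HsM cs; have Is : I s by exact: I4k.
have {}cos1 l : cos (pi * (s - c l) / 2) = 1.
  by rewrite -[RHS](cos1 ((s - c l) / 4)) ?Ic ?Hc//; congr cos; field.
by have := c_ij s; rewrite !cos1; lra.
Qed.
End limit.
End transfer.

(** * The Fourier transform of the middle-fourth Cantor measure *)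

Section cantor.
Context (R : realType).
Local Notation C := R[i].
Local Notation Re := complex.Re.
Local Notation Im := complex.Im.
Variable mu : probability (measurableTypeR R) R.
Hypothesis mu_cantor : middle_fourth_cantor mu.

Let measurable_tau1 :
  measurable_fun setT (@tau1 R : measurableTypeR R -> measurableTypeR R).
Proof.
apply: continuous_measurable_fun => x.
by apply: cvgM; [exact: cvg_cst|exact: cvg_id].
Qed.

Let measurable_tau2 :
  measurable_fun setT (@tau2 R : measurableTypeR R -> measurableTypeR R).
Proof.
apply: continuous_measurable_fun => x.
by apply: cvgM; [exact: cvg_cst|apply: cvgD; [exact: cvg_id|exact: cvg_cst]].
Qed.

(** The self-similarity of mu, tested against functions instead of sets. *)
Lemma ge0_integral_cantor (f : R -> R) :
  measurable_fun setT (f : measurableTypeR R -> R) -> (forall x, 0 <= f x) ->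
  (\int[mu]_x (f x)%:E = (2^-1)%:E * \int[mu]_x (f (tau1 x))%:E
    + (2^-1)%:E * \int[mu]_x (f (tau2 x))%:E)%E.
Proof.
move=> mf f0.
have h0 : 0 <= 2^-1 :> R by [].
pose h : {nonneg R} := NngNum h0.
have mf' : measurable_fun setT (EFin \o f : measurableTypeR R -> \bar R).
  exact/measurable_EFinP.
pose nu1 : {measure set (measurableTypeR R) -> \bar R} :=
  measure_function_pushforward__canonical__measure_function_Measure mu measurable_tau1.
pose nu2 : {measure set (measurableTypeR R) -> \bar R} :=
  measure_function_pushforward__canonical__measure_function_Measure mu measurable_tau2.
rewrite (eq_measure_integral (measure_add (mscale h nu1) (mscale h nu2))); last first.
  by move=> A mA _; rewrite [RHS]measure_addE; exact: mu_cantor.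
rewrite ge0_integral_measure_add//; last by move=> x _; rewrite lee_fin.
rewrite !ge0_integral_mscale//; try by move=> x _; rewrite lee_fin.
by rewrite !ge0_integral_pushforward//; try by move=> x _; rewrite lee_fin.
Qed.

(** A bounded function is made nonnegative by adding a constant. *)
Lemma Rintegral_cantor (f : R -> R) : @bmfun R _ (measurableTypeR R) f ->
  \int[mu]_x f x = 2^-1 * (\int[mu]_x f (tau1 x)) + 2^-1 * (\int[mu]_x f (tau2 x)).
Proof.
move=> [mf [K fK]].
have bf (g : R -> R) : measurable_fun setT (g : measurableTypeR R -> measurableTypeR R) ->
    @bmfun R _ (measurableTypeR R) (fun x => f (g x)).
  by move=> mg; split; [exact: (measurableT_comp mf mg)|exists K => x].
have bK := @bmfun_cst R _ (measurableTypeR R) K.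
have shift (g : R -> R) : @bmfun R _ (measurableTypeR R) g ->
    (\int[mu]_x (g x + K)%:E)%E = ((\int[mu]_x g x) + K)%:E.
  move=> bg; rewrite -[LHS]fineK; last first.
    by apply: integrable_fin_num => //; exact/bmfun_integrable/bmfunD.
  congr EFin; rewrite -[LHS]/(\int[mu]_x (g x + K)) RintegralD//.
  - by rewrite Rintegral_probability_cst.
  - exact: bmfun_integrable.
  - exact: bmfun_integrable.
have fK0 x : 0 <= f x + K by have := fK x; rewrite ler_norml; lra.
have mfK : measurable_fun setT (fun x : measurableTypeR R => f x + K).
  by apply: measurable_funD => //; exact: measurable_cst.
have := ge0_integral_cantor mfK fK0.
rewrite (shift f); last by split=> //; exists K.
have -> : (\int[mu]_x (f (tau1 x) + K)%:E)%E = ((\int[mu]_x f (tau1 x)) + K)%:E.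
  exact: (shift (fun x => f (tau1 x)) (bf _ measurable_tau1)).
have -> : (\int[mu]_x (f (tau2 x) + K)%:E)%E = ((\int[mu]_x f (tau2 x)) + K)%:E.
  exact: (shift (fun x => f (tau2 x)) (bf _ measurable_tau2)).
rewrite -!EFinM -EFinD => -[].
by lra.
Qed.

Lemma fourier_cantor t :
  fourier mu t + fourier mu t = (1 + expi (t / 2) 1) * fourier mu (t / 4).
Proof.
have [mc ms] := @cbmfun_expi R t.
have dbl (f : R -> R) : @bmfun R _ (measurableTypeR R) f ->
    \int[mu]_x f x + \int[mu]_x f x = \int[mu]_x f (tau1 x) + \int[mu]_x f (tau2 x).
  by move=> /Rintegral_cantor ->; lra.
transitivity (cintegral mu (fun x => expi t (tau1 x)) +
              cintegral mu (fun x => expi t (tau2 x))).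
  by apply: complex_ext; rewrite !(cReD, cImD)/=; [exact: dbl|exact: dbl].
rewrite mulrDl mul1r; congr (_ + _).
  congr cintegral; apply/funext => x.
  by congr (cos _ +i* sin _)%C; rewrite /tau1; field.
rewrite -cintegralZ; last exact: cbmfun_expi.
congr cintegral; apply/funext => x.
have -> : expi (t / 2) 1 = expi (t / 4) 2 :> C.
  by congr (cos _ +i* sin _)%C; field.
rewrite -!(expi_sym _ (t / 4)) -expiD expi_sym.
by congr (cos _ +i* sin _)%C; rewrite /tau2; field.
Qed.

Lemma sqn_fourier t :
  sqn (fourier mu t) = cos (pi * t / 2) ^+ 2 * sqn (fourier mu (t / 4)).
Proof.
have := congr1 (@sqn R) (fourier_cantor t); rewrite sqnM.
have -> : sqn (fourier mu t + fourier mu t) = 4 * sqn (fourier mu t).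
  by rewrite /sqn cReD cImD; ring.
have -> : sqn (1 + expi (t / 2) 1) = 4 * cos (pi * t / 2) ^+ 2 :> R.
  rewrite /sqn cReD cImD /=.
  have -> : 2 * pi * (t / 2) * 1 = (pi * t / 2) *+ 2 by rewrite -mulr_natl; field.
  by rewrite cos_mulr2n sin_mulr2n; have := cos2Dsin2 (pi * t / 2); nra.
by move=> ?; lra.
Qed.

Lemma fourier_mul4 (z : int) : fourier mu (4 * z%:~R) = fourier mu z%:~R.
Proof.
have := fourier_cantor (4 * z%:~R).
have -> : 4 * z%:~R / 2 = (2 * z)%:~R :> R by rewrite rmorphM/=; field.
rewrite expi_int (_ : 4 * z%:~R / 4 = z%:~R); last by field.
move=> E; apply: (@mulfI _ (1 + 1 : C)); last by rewrite -E mulrDl !mul1r.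
by rewrite -mulr2n pnatr_eq0.
Qed.

(** For t odd, the two halves of the measure contribute with opposite phases. *)
Lemma fourier_odd (k : int) : fourier mu (2 * k + 1)%:~R = 0.
Proof.
have := fourier_cantor (2 * k + 1)%:~R.
have -> : (2 * k + 1)%:~R / 2 = k%:~R + 2^-1 :> R.
  by rewrite rmorphD rmorphM/=; field.
by rewrite expiD expi_int mul1r expi_half subrr mul0r => /eqP; rewrite -mulr2n mulrn_eq0 => /eqP.
Qed.

Lemma fourier_pow4_odd (n : nat) (k : int) :
  fourier mu (4 ^+ n * (2 * k + 1))%:~R = 0.
Proof.
elim: n => [|n IH]; first by rewrite expr0 mul1r fourier_odd.
by rewrite exprS -mulrA rmorphM/= fourier_mul4.
Qed.

Lemma sqn_fourier_le1 t : sqn (fourier mu t) <= 1.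
Proof.
have := @pythagoras R mu t [:: 0] (fun i => fourier mu (t - i)) erefl.
move=> /(_ _)/wrap[].
  by move=> i j; rewrite !inE => /eqP -> /eqP ->; rewrite eqxx.
have sqn0 : sqn (0 : C) = 0 by rewrite /sqn/= !expr0n/= addr0.
rewrite !big_seq1 subrr subr0 sqn0 addr0.
have := energy_ge0 mu (fun x => expi t x - \sum_(i <- [:: 0]) fourier mu (t - i) * expi i x).
by move=> + E; rewrite E lee_fin subr_ge0.
Qed.

(** If |tau_i(x)| > a, then |x| > 4a - 2, so that mu(|x| > a) <=
    mu(|x| > a + 1) as soon as a >= 2.  Iterating, mu(|x| > 2) is bounded by
    mu(|x| > 2 + n), which tends to 0. *)
Lemma support_cantor : {ae mu, forall x : R, `|x| <= 2}.
Proof.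
pose F (a : R) : set (measurableTypeR R) := [set x : R | a < `|x|].
have mF a : measurable (F a).
  have mn : measurable_fun setT (fun x : measurableTypeR R => `|x| : R).
    by apply: continuous_measurable_fun; exact: norm_continuous.
  rewrite (_ : F a = (fun x : R => `|x|) @^-1` `]a, +oo[%classic); last first.
    by apply/seteqP; split => x /=; rewrite in_itv/= andbT.
  by rewrite -[X in measurable X]setTI; apply: mn.
have Fle (a b : R) : a <= b -> (mu (F b) <= mu (F a))%E.
  by move=> ab; apply: le_measure; rewrite ?inE// => x /=; exact: le_lt_trans.
have F4 (a : R) : 2 <= a -> (mu (F a) <= mu (F (a + 1)%R))%E.
  move=> a2; apply: (@le_trans _ _ (mu (F (4 * a - 2)%R))); last by apply: Fle; lra.
  have sub tau : measurable_fun setT (tau : measurableTypeR R -> measurableTypeR R) ->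
     (forall x : R, a < `|tau x| -> 4 * a - 2 < `|x|) ->
      (pushforward mu tau (F a) <= mu (F (4 * a - 2)%R))%E.
    move=> mt h; rewrite /pushforward; apply: le_measure; rewrite ?inE//.
    by rewrite -[X in measurable X]setTI; apply: mt.
  rewrite mu_cantor//.
  apply: (@le_trans _ _ ((2^-1)%:E * mu (F (4 * a - 2)%R) + (2^-1)%:E * mu (F (4 * a - 2)%R))%E).
    apply: leeD; apply: lee_wpmul2l => //; apply: sub => // x; rewrite /tau1 /tau2 normrM.
      by rewrite [`|4^-1|]ger0_norm//; lra.
    by rewrite [`|4^-1|]ger0_norm//; have := ler_normD x 2; rewrite [`|2|]ger0_norm//; lra.
  rewrite -ge0_muleDl ?lee_fin//.
  by rewrite -EFinD (_ : 2^-1 + 2^-1 = 1) ?mul1e//; lra.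
have Fn n : (mu (F 2%R) <= mu (F (2 + n%:R)%R))%E.
  elim: n => [|n IH]; first by rewrite addr0.
  by rewrite (le_trans IH)// -[n.+1%:R]natr1 addrA; apply: F4; rewrite lerDl.
have F0 : \bigcap_n F (2 + n%:R)%R = set0.
  rewrite -subset0 => x /(_ (Num.Def.archi_bound `|x|) I) /=.
  apply/negP; rewrite -leNgt; have := archi_boundP (normr_ge0 x); lra.
have : mu (F (2 + n%:R)%R) @[n --> \oo] --> mu (\bigcap_n F (2 + n%:R)%R).
  apply: nonincreasing_cvg_mu => //.
  - by rewrite (le_lt_trans (probability_le1 _ _))// ltry.
  - by rewrite F0; exact: measurable0.
  - move=> n m nm; apply/subsetPset => x /=; apply: le_lt_trans.
    by rewrite lerD2l ler_nat.
rewrite F0 measure0 => cF.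
have {}cF : mu (F 2%R) = 0.
  apply/le_anti; rewrite measure_ge0 andbT.
  by apply: (cvge_ge _ cF); apply: nearW.
exists (F 2); split => // x /= /negP; rewrite -ltNge//.
Qed.

Lemma Rintegral_le_ae (h : R -> R) L : @bmfun R _ (measurableTypeR R) h ->
  (forall x, `|x| <= 2 -> `|h x| <= L) -> `|\int[mu]_x h x| <= L.
Proof.
move=> bh hL; have L0 : 0 <= L by rewrite (le_trans _ (hL 0 _)) ?normr0.
have ih := bmfun_integrable mu bh.
rewrite (le_trans (le_normr_Rintegral _ ih))//.
have bn : @bmfun R _ (measurableTypeR R) (fun x => `|h x|).
  case: bh => mh [K hK]; split; first exact: measurableT_comp.
  by exists K => x; rewrite normr_id.
rewrite -(Rintegral_probability_cst mu L).
apply: fine_le.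
- by apply: integrable_fin_num => //; exact: bmfun_integrable.
- by apply: integrable_fin_num => //; apply: bmfun_integrable; exact: bmfun_cst.
apply: ae_ge0_le_integral => //.
- by apply/measurable_EFinP; case: bn.
have [N [mN N0 subN]] := support_cantor.
exists N; split => // x nx; apply: subN => x2.
by apply: nx => _; rewrite lee_fin hL.
Qed.

(** On the support |x| <= 2, the integrands cos(2 pi t x) and sin(2 pi t x) are
    Lipschitz in t with constant 4 pi. *)
Lemma sqn_fourier_lipschitz s t :
  `|sqn (fourier mu s) - sqn (fourier mu t)| <= 16 * pi * `|s - t|.
Proof.
have [bRs bIs] := @cbmfun_expi R s; have [bRt bIt] := @cbmfun_expi R t.
have dist (f : R -> R) : (forall x y, `|f x - f y| <= `|x - y|) ->
    forall x, `|x| <= 2 ->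
    `|f (2 * pi * s * x) - f (2 * pi * t * x)| <= 4 * pi * `|s - t|.
  move=> fL x x2; rewrite (le_trans (fL _ _))//.
  have -> : 2 * pi * s * x - 2 * pi * t * x = 2 * pi * (s - t) * x by ring.
  rewrite !normrM (ger0_norm (pi_ge0 R)) ger0_norm//.
  have := pi_ge0 R; have := normr_ge0 (s - t); move: x2.
  move: `|x| `|s - t| (pi : R) => a b p a2 b0 p0.
  have : 0 <= p * b by rewrite mulr_ge0.
  nra.
have le1 (f : R -> R) : @bmfun R _ (measurableTypeR R) f -> (forall x, `|f x| <= 1) ->
    `|\int[mu]_x f x| <= 1.
  by move=> bf f1; apply: Rintegral_le_ae.
have sq (a b : R) : `|a| <= 1 -> `|b| <= 1 -> `|a - b| <= 4 * pi * `|s - t| ->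
    `|a ^+ 2 - b ^+ 2| <= 8 * pi * `|s - t|.
  move=> a1 b1 ab; rewrite subr_sqr normrM.
  have ab2 : `|a + b| <= 2 by rewrite (le_trans (ler_normD _ _))//; lra.
  have := ler_pM (normr_ge0 _) (normr_ge0 _) ab ab2; lra.
have dRe := Rintegral_le_ae (bmfunD bRs (bmfunN bRt)) (dist cos (@cos_dist R)).
have dIm := Rintegral_le_ae (bmfunD bIs (bmfunN bIt)) (dist sin (@sin_dist R)).
move: dRe dIm; rewrite !RintegralB//; try exact: bmfun_integrable.
move=> dRe dIm.
have sqRe := sq _ _ (le1 _ bRs (fun x => cos_max _)) (le1 _ bRt (fun x => cos_max _)) dRe.
have sqIm := sq _ _ (le1 _ bIs (fun x => sin_max _)) (le1 _ bIt (fun x => sin_max _)) dIm.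
rewrite /sqn opprD addrACA (le_trans (ler_normD _ _))//.
have := lerD sqRe sqIm; rewrite -!/(Re (fourier mu _)); lra.
Qed.
End cantor.

(** * The closed span of a set of exponentials *)

Section closure.
Context (R : realType).
Local Notation C := R[i].
Local Notation Re := complex.Re.
Local Notation Im := complex.Im.
Variable mu : probability (measurableTypeR R) R.
Implicit Types (S T : set R) (l : seq (R * C)) (F G : R -> C).

Lemma energyD_lt F G (d e : R) : @cmfun R _ (measurableTypeR R) F ->
  @cmfun R _ (measurableTypeR R) G ->
  (energy mu F < d%:E)%E -> (energy mu G < e%:E)%E ->
  (energy mu (fun x => F x + G x)%R < (2 * d + 2 * e)%:E)%E.
Proof.
move=> mF mG Fd Ge; apply: le_lt_trans (energyD_le mu mF mG) _.
by rewrite [ltRHS]EFinD (EFinM 2 d) (EFinM 2 e) lteD// lte_pmul2l.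
Qed.

Definition spectral_in S l := forall p, p \in l -> S p.1.

(** The functions that are limits in L^2(mu) of trigonometric polynomials with
    frequencies in S. *)
Definition trig_closure S : set (R -> C) := [set F |
  @cmfun R _ (measurableTypeR R) F /\
  forall e : R, 0 < e -> exists l, spectral_in S l /\
    (energy mu (fun x => F x - trig l x)%R < e%:E)%E].

Lemma cmfun_trig l : @cmfun R _ (measurableTypeR R) (trig l).
Proof. exact/cbmfun_cmfun/cbmfun_trig. Qed.

Lemma energy_cst0 : energy mu (fun=> 0) = 0%E.
Proof.
rewrite /energy (_ : (fun _ => _) = cst 0%E) ?integral0//.
by apply/funext => x; rewrite /sqn/= expr0n/= addr0.
Qed.

Lemma trig_closure_trig S l : spectral_in S l -> trig_closure S (trig l).
Proof.
move=> Sl; split; first exact: cmfun_trig.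
move=> e e0; exists l; split => //.
rewrite (_ : (fun _ => _) = fun=> 0) ?energy_cst0 ?lte_fin//.
by apply/funext => x; rewrite subrr.
Qed.

Lemma trig_closure_lim S F : @cmfun R _ (measurableTypeR R) F ->
  (forall e : R, 0 < e -> exists2 G, trig_closure S G &
    (energy mu (fun x => F x - G x)%R < e%:E)%E) -> trig_closure S F.
Proof.
move=> mF H; split=> // e e0.
have e4 : 0 < e / 4 by rewrite divr_gt0.
have [G [mG /(_ _ e4)[l [Sl Gl]]] FG] := H _ e4.
exists l; split => //.
rewrite (_ : (fun _ => _) = fun x => (F x - G x) + (G x - trig l x)); last first.
  by apply/funext => x; rewrite addrA subrK.
rewrite (_ : e = 2 * (e / 4) + 2 * (e / 4)); last by lra.
by apply: energyD_lt => //; apply: cmfunB => //; exact: cmfun_trig.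
Qed.

Lemma trig_closureD S F G : trig_closure S F -> trig_closure S G ->
  trig_closure S (fun x => F x + G x).
Proof.
move=> [mF clF] [mG clG]; split; first exact: cmfunD.
move=> e e0; have e4 : 0 < e / 4 by rewrite divr_gt0.
have [l [Sl Fl]] := clF _ e4; have [k [Sk Gk]] := clG _ e4.
exists (l ++ k); split.
  by move=> p; rewrite mem_cat => /orP[/Sl|/Sk].
rewrite (_ : (fun _ => _) = fun x => (F x - trig l x) + (G x - trig k x)); last first.
  by apply/funext => x; rewrite /trig big_cat/= opprD addrACA.
rewrite (_ : e = 2 * (e / 4) + 2 * (e / 4)); last by lra.
by apply: energyD_lt => //; apply: cmfunB => //; exact: cmfun_trig.
Qed.

Lemma trig_closureZ S a F : trig_closure S F -> trig_closure S (fun x => a * F x).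
Proof.
move=> [mF clF]; split; first exact/cmfunM/mF/cmfun_cst.
move=> e e0; have b0 : 0 < sqn a + 1 by rewrite ltr_wpDl// sqn_ge0.
have eb : 0 < e / (sqn a + 1) by rewrite divr_gt0.
have [l [Sl Fl]] := clF _ eb.
exists [seq (p.1, a * p.2) | p <- l]; split.
  by move=> _ /mapP[p /Sl ? ->].
rewrite (_ : (fun _ => _) = fun x => a * (F x - trig l x)); last first.
  apply/funext => x; rewrite mulrBr /trig big_map mulr_sumr; congr (_ - _).
  by apply: eq_bigr => p _; rewrite mulrA.
rewrite energyZ; last by apply: cmfunB => //; exact: cmfun_trig.
have := energy_ge0 mu (fun x => F x - trig l x); move: Fl.
case: energy => [r| |]//; rewrite lte_fin lee_fin -EFinM lte_fin => re r0.
apply: le_lt_trans (_ : (sqn a + 1) * r < _).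
  by rewrite ler_wpM2r// lerDl.
by rewrite mulrC -ltr_pdivlMr.
Qed.

Lemma trig_closureB S F G : trig_closure S F -> trig_closure S G ->
  trig_closure S (fun x => F x - G x).
Proof.
move=> SF SG; rewrite (_ : (fun _ => _) = fun x => F x + -1 * G x).
  exact/trig_closureD/trig_closureZ.
by apply/funext => x; rewrite mulN1r.
Qed.

Lemma trig_closure0 S : trig_closure S (fun=> 0).
Proof.
rewrite (_ : (fun _ => _) = trig [::]); first exact: trig_closure_trig.
by apply/funext => x; rewrite /trig big_nil.
Qed.

Lemma trig_closure_sum S I (s : seq I) (P : pred I) (F : I -> R -> C) :
  (forall i, P i -> trig_closure S (F i)) ->
  trig_closure S (fun x => \sum_(i <- s | P i) F i x).
Proof.
move=> SF; elim: s => [|i s IH].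
  rewrite (_ : (fun _ => _) = fun=> 0); first exact: trig_closure0.
  by apply/funext => x; rewrite big_nil.
have [Pi|Pi] := boolP (P i).
  rewrite (_ : (fun _ => _) = fun x => F i x + \sum_(i <- s | P i) F i x).
    by apply: trig_closureD => //; exact: SF.
  by apply/funext => x; rewrite big_cons Pi.
rewrite (_ : (fun _ => _) = fun x => \sum_(i <- s | P i) F i x)//.
by apply/funext => x; rewrite big_cons (negbTE Pi).
Qed.

(** It is enough to approximate the exponentials of a total family. *)
Lemma trig_closure_trans S T F : (forall t, T t -> trig_closure S (expi t)) ->
  trig_closure T F -> trig_closure S F.
Proof.
move=> TS [mF clF]; apply: trig_closure_lim => // e e0.
have [l [Tl Fl]] := clF _ e0; exists (trig l) => //.
rewrite /trig; elim: l Tl {Fl} => [|p l IH] Tl.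
  rewrite (_ : (fun _ => _) = fun=> 0); first exact: trig_closure0.
  by apply/funext => x; rewrite big_nil.
rewrite (_ : (fun _ => _) = fun x => p.2 * expi p.1 x + \sum_(p <- l) p.2 * expi p.1 x).
  apply: trig_closureD; last by apply: IH => q ql; apply: Tl; rewrite inE ql orbT.
  by apply/trig_closureZ/TS/Tl; rewrite inE eqxx.
by apply/funext => x; rewrite big_cons.
Qed.

Lemma trig_closure_dominated S (F_ : nat -> R -> C) F (g : R -> R) :
  (forall n, trig_closure S (F_ n)) -> @cmfun R _ (measurableTypeR R) F ->
  mu.-integrable setT (EFin \o g) ->
  {ae mu, forall x, sqn (F x - F_ n x) @[n --> \oo] --> 0} ->
  {ae mu, forall x, forall n, sqn (F x - F_ n x) <= g x} ->
  trig_closure S F.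
Proof.
move=> SF mF ig cvF Fg; apply: trig_closure_lim => // e e0.
have mf n : measurable_fun setT (fun x : measurableTypeR R => (sqn (F x - F_ n x))%:E).
  apply/measurable_EFinP/measurable_sqn; apply: cmfunB => //.
  by have [] := SF n.
have [] := @dominated_convergence _ _ _ mu setT measurableT _ (cst 0%E) _
  mf (measurable_cst _) _ ig _.
- have [N [mN N0 subN]] := cvF; exists N; split => // x nx; apply: subN => Fx.
  by apply: nx => _; apply: cvg_EFin; [exact: nearW|exact: Fx].
- have [N [mN N0 subN]] := Fg; exists N; split => // x nx; apply: subN => Fx.
  by apply: nx => n _; rewrite /= lee_fin ger0_norm ?sqn_ge0.
move=> _ _; rewrite integral_cst// mul0e => /fine_cvgP[fin cv].
have [n _ nlt] : \forall n \near \oo, (energy mu (fun x => F x - F_ n x)%R < e%:E)%E.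
  near=> n; rewrite -[ltLHS]fineK; last by near: n; exact: fin.
  by rewrite lte_fin; near: n; exact: (cvgr_lt _ cv).
by exists (F_ n); [exact: SF|apply: nlt => /=].
Unshelve. all: by end_near. Qed.
End closure.

(** * Polynomials converging to a step function *)

Section step.
Context (R : realType).
Implicit Types (w y : R).

Lemma bernoulli_ge y n : 0 <= y <= 1 -> 1 - n%:R * y <= (1 - y) ^+ n.
Proof.
move=> /andP[y0 y1]; elim: n => [|n IH]; first by rewrite mul0r subr0 expr0.
have y1' : 0 <= 1 - y by rewrite subr_ge0.
rewrite exprS (le_trans _ (ler_wpM2l y1' IH))// -natr1.
have : 0 <= n%:R * y ^+ 2 by rewrite mulr_ge0 ?sqr_ge0.
lra.
Qed.

Lemma bernoulli_le y n : 0 <= y <= 1 -> (1 - y) ^+ n * (1 + n%:R * y) <= 1.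
Proof.
move=> /andP[y0 y1]; have y1' : 0 <= 1 - y by rewrite subr_ge0.
have h : 1 + n%:R * y <= (1 + y) ^+ n.
  elim: n => [|n IH]; first by rewrite mul0r addr0 expr0.
  have y1'' : 0 <= 1 + y by rewrite addr_ge0.
  rewrite exprS (le_trans _ (ler_wpM2l y1'' IH))// -natr1.
  have : 0 <= n%:R * y ^+ 2 by rewrite mulr_ge0 ?sqr_ge0.
  lra.
rewrite (le_trans (ler_wpM2l (exprn_ge0 n y1') h))// -exprMn exprn_ile1//.
  by rewrite -subr_sqr expr1n subr_ge0 exprn_ile1.
by rewrite -subr_sqr expr1n gerBl sqr_ge0.
Qed.

(** By Bernoulli's inequality, (1 - y^n)^(2^n) is at least 1 - (2y)^n and at
    most (2y)^(-n): it tends to 1 for y < 1/2 and to 0 for y > 1/2. *)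
Definition power_step n y : R := (1 - y ^+ n) ^+ (2 ^ n).

Lemma power_step_01 n y : 0 <= y <= 1 -> 0 <= power_step n y <= 1.
Proof.
move=> /andP[y0 y1].
have yn : 0 <= 1 - y ^+ n by rewrite subr_ge0 exprn_ile1.
by rewrite exprn_ge0// exprn_ile1// gerBl exprn_ge0.
Qed.

Lemma cvg_power_step_lt y : 0 <= y < 2^-1 -> power_step n y @[n --> \oo] --> (1 : R).
Proof.
move=> /andP[y0 y2]; have y1 : y <= 1 by rewrite (le_trans (ltW y2))// invf_le1// ler1n.
apply: (@squeeze_cvgr _ _ _ _ (fun n => 1 - (2 * y) ^+ n) (cst 1)).
- near=> n; have y01 : 0 <= y <= 1 by rewrite y0.
  have /andP[_ ->] := power_step_01 n y01; rewrite andbT exprMn -natrX.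
  by apply: bernoulli_ge; rewrite exprn_ge0// exprn_ile1.
- rewrite -[X in _ --> X]subr0; apply: cvgB; first exact: cvg_cst.
  apply: cvg_expr; rewrite ger0_norm ?mulr_ge0//; lra.
- exact: cvg_cst.
Unshelve. all: by end_near. Qed.

Lemma cvg_power_step_gt y : 2^-1 < y <= 1 -> power_step n y @[n --> \oo] --> (0 : R).
Proof.
move=> /andP[y2 y1]; have y0 : 0 <= y by rewrite (le_trans _ (ltW y2)).
have yy : 1 < 2 * y by lra.
apply: (@squeeze_cvgr _ _ _ _ (cst 0) (fun n => (2 * y)^-1 ^+ n)).
- near=> n; have /andP[-> _] := @power_step_01 n y (introT andP (conj y0 y1)).
  have yn0 : 0 < (2 * y) ^+ n by apply: exprn_gt0; lra.
  rewrite /= exprVn -[leRHS]mul1r ler_pdivlMr//.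
  have yn : 0 <= y ^+ n <= 1 by rewrite exprn_ge0// exprn_ile1.
  rewrite (le_trans _ (bernoulli_le (2 ^ n) yn))// ler_wpM2l//.
    by rewrite exprn_ge0// subr_ge0; case/andP: yn.
  by rewrite exprMn natrX lerDr.
- exact: cvg_cst.
- apply: cvg_expr; rewrite ger0_norm ?invr_ge0 ?invf_lt1//; lra.
Unshelve. all: by end_near. Qed.

(** At w = 0 the first factor has y = 1/2 and tends to neither 0 nor 1.  The
    convex combination with (1 - w^2)^n, which tends to the indicator of w = 0,
    replaces the value there by 1, so that the limit is exactly the indicator
    of w <= 0. *)
Definition step_approx n w : R :=
  power_step n ((1 + w) / 2) * (1 - (1 - w ^+ 2) ^+ n) + (1 - w ^+ 2) ^+ n.

Lemma step_approx_01 n w : -1 <= w <= 1 -> 0 <= step_approx n w <= 1.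
Proof.
move=> w1; have u01 : 0 <= (1 - w ^+ 2) ^+ n <= 1.
  have w2 : 0 <= 1 - w ^+ 2 by nra.
  by rewrite exprn_ge0// exprn_ile1// gerBl sqr_ge0.
have : 0 <= power_step n ((1 + w) / 2) <= 1 by apply: power_step_01; lra.
rewrite /step_approx; move: (power_step _ _) (_ ^+ n) u01 => a b b01 a01.
nra.
Qed.

Lemma cvg_step_approx w : -1 <= w <= 1 ->
  step_approx n w @[n --> \oo] --> ((w <= 0)%R%:R : R).
Proof.
move=> w1; have cu : w != 0 -> (1 - w ^+ 2) ^+ n @[n --> \oo] --> (0 : R).
  move=> w0; apply: cvg_expr.
  have : 0 < w ^+ 2 by rewrite exprn_even_gt0.
  rewrite ger0_norm; nra.
have lim (a : R) : w != 0 -> power_step n ((1 + w) / 2) @[n --> \oo] --> a ->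
    step_approx n w @[n --> \oo] --> a.
  move=> w0 ca; rewrite (_ : a = a * (1 - 0) + 0); last by ring.
  apply: cvgD; last exact: cu.
  by apply: cvgM ca _; apply: cvgB; [exact: cvg_cst|exact: cu].
have [w0|w0|->] := ltgtP w 0.
- by apply: lim; [rewrite lt_eqF|apply: cvg_power_step_lt; lra].
- by apply: lim; [rewrite gt_eqF|apply: cvg_power_step_gt; lra].
- rewrite (_ : step_approx^~ 0 = cst 1); first exact: cvg_cst.
  by apply/funext => n; rewrite /step_approx expr0n/= subr0 expr1n subrr mulr0 add0r.
Qed.
End step.

(** * Totality of the exponentials with frequencies in (1/8)Z *)

Section totality.
Context (R : realType).
Local Notation C := R[i].
Local Notation Re := complex.Re.
Local Notation Im := complex.Im.

Definition grid : set R := [set q%:~R / 8 | q in [set: int]].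

Lemma gridD s t : grid s -> grid t -> grid (s + t).
Proof. by move=> [p _ <-] [q _ <-]; exists (p + q) => //; rewrite intrD mulrDl. Qed.

Definition trig_poly (F : R -> C) := exists2 l, spectral_in grid l & F = trig l.

Lemma trig_poly_cst a : trig_poly (fun=> a).
Proof.
exists [:: (0, a)].
  by move=> p; rewrite inE => /eqP ->; exists 0 => //; rewrite mul0r.
by apply/funext => x; rewrite /trig big_seq1 expi0 mulr1.
Qed.

Lemma trig_polyD F G : trig_poly F -> trig_poly G -> trig_poly (fun x => F x + G x).
Proof.
move=> [l Tl ->] [k Tk ->]; exists (l ++ k).
  by move=> p; rewrite mem_cat => /orP[/Tl|/Tk].
by apply/funext => x; rewrite /trig big_cat.
Qed.

Lemma trig_polyM F G : trig_poly F -> trig_poly G -> trig_poly (fun x => F x * G x).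
Proof.
move=> [l Tl ->] [k Tk ->].
exists [seq (p.1 + q.1, p.2 * q.2) | p <- l, q <- k].
  by move=> _ /allpairsP[[p q] /= [/Tl ? /Tk ? ->]]; exact: gridD.
apply/funext => x; rewrite /trig big_allpairs_dep mulr_suml; apply: eq_bigr => p _.
by rewrite mulr_sumr; apply: eq_bigr => q _; rewrite expiD mulrACA.
Qed.

Definition real_trig_poly (g : R -> R) := trig_poly (fun x => (g x)%:C%C).

Lemma real_trig_poly_cst a : real_trig_poly (fun=> a).
Proof. exact: trig_poly_cst. Qed.

Lemma eq_trig_poly F G : F =1 G -> trig_poly F -> trig_poly G.
Proof. by move=> /funext ->. Qed.

Lemma real_trig_polyD f g : real_trig_poly f -> real_trig_poly g ->
  real_trig_poly (fun x => f x + g x).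
Proof.
by move=> pf pg; apply: eq_trig_poly (trig_polyD pf pg) => x; rewrite -rmorphD.
Qed.

Lemma real_trig_polyM f g : real_trig_poly f -> real_trig_poly g ->
  real_trig_poly (fun x => f x * g x).
Proof.
by move=> pf pg; apply: eq_trig_poly (trig_polyM pf pg) => x; rewrite -rmorphM.
Qed.

Lemma real_trig_polyN f : real_trig_poly f -> real_trig_poly (fun x => - f x).
Proof.
move=> pf; apply: eq_trig_poly (real_trig_polyM (real_trig_poly_cst (-1)) pf) => x.
by rewrite mulN1r.
Qed.

Lemma real_trig_polyX n f : real_trig_poly f -> real_trig_poly (fun x => f x ^+ n).
Proof.
move=> pf; elim: n => [|n IH]; first exact: real_trig_poly_cst.
by apply: eq_trig_poly (real_trig_polyM pf IH) => x; rewrite exprS.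
Qed.

(** The frequency 1/8 is chosen so that pi x / 4 stays in [-pi/2, pi/2] for
    |x| <= 2; there sin(pi x / 4) is increasing. *)
Lemma real_trig_poly_sin : real_trig_poly (fun x => sin (pi * x / 4)).
Proof.
(* sin = (e^(i u) - e^(- i u)) / (2i), and 1/(2i) = - i/2. *)
pose a : C := (0 +i* (- 2^-1))%C.
exists [:: (8^-1, a); (- 8^-1, - a)].
  move=> p; rewrite !inE => /orP[]/eqP ->.
    by exists 1 => //; rewrite mul1r.
  by exists (-1) => //=; rewrite mulN1r.
apply/funext => x; rewrite /trig !big_cons big_nil addr0 /= -expiJ /expi.
have -> : 2 * pi / 8 * x = pi * x / 4 :> R by field.
by apply: complex_ext; rewrite !(cReD, cImD, cReM, cImM, cReN, cImN, cReJ, cImJ)/=; field.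
Qed.

Lemma real_trig_poly_step n f : real_trig_poly f ->
  real_trig_poly (fun x => step_approx n (f x)).
Proof.
move=> pf; have c := real_trig_poly_cst.
have pu : real_trig_poly (fun x => (1 - f x ^+ 2) ^+ n).
  by apply/real_trig_polyX/real_trig_polyD => //; exact/real_trig_polyN/real_trig_polyX.
apply: real_trig_polyD => //; apply: real_trig_polyM; last first.
  by apply: real_trig_polyD => //; exact: real_trig_polyN.
apply/real_trig_polyX/real_trig_polyD => //; apply/real_trig_polyN/real_trig_polyX.
by apply: real_trig_polyM => //; exact: real_trig_polyD.
Qed.

Lemma sqn_realB (a b : R) : sqn (a%:C%C - b%:C%C) = (a - b) ^+ 2.
Proof. by rewrite -rmorphB /sqn/= expr0n/= addr0. Qed.

(** On [-2, 2], half-lines are sublevel sets of sin(pi x / 4).  For a outside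
    [-2, 2] a threshold b = -2 or 2 that the sine never reaches will do. *)
Lemma ray_sin (a : R) : exists b : R, forall x, `|x| <= 2 ->
  (x <= a) = (sin (pi * x / 4) <= b).
Proof.
have [a2|a2] := ltP a (-2).
  exists (-2) => x; rewrite ler_norml => /andP[x2 _].
  rewrite leNgt (lt_le_trans a2 x2)/=; apply/esym/negbTE; rewrite -ltNge.
  by rewrite (lt_le_trans _ (sin_geN1 _))//; lra.
have [a2'|a2'] := ltP 2 a.
  exists 2 => x; rewrite ler_norml => /andP[_ x2].
  rewrite (le_trans x2 (ltW a2')); apply/esym.
  by rewrite (le_trans (sin_le1 _))//; lra.
exists (sin (pi * a / 4)) => x; rewrite ler_norml => /andP[x2 x2'].
have inI (y : R) : -2 <= y -> y <= 2 -> pi * y / 4 \in `[(- (pi / 2)), (pi / 2)].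
  by move=> y2 y2'; have := pi_gt0 R; rewrite in_itv/= => p0; apply/andP; split; nra.
rewrite !leNgt ltr_sin ?inI// ltr_pM2r ?invr_gt0// ltr_pM2l ?pi_gt0//.
Qed.

Variable mu : probability (measurableTypeR R) R.
Hypothesis mu_support : {ae mu, forall x : R, `|x| <= 2}.
Local Notation closure := (trig_closure mu grid).

Lemma cmfun_real (g : R -> R) : measurable_fun setT (g : measurableTypeR R -> R) ->
  @cmfun R _ (measurableTypeR R) (fun x => (g x)%:C%C).
Proof. by move=> mg; split => //=; exact: measurable_cst. Qed.

Lemma closure_trig_poly F : trig_poly F -> closure F.
Proof. by move=> [l Tl ->]; exact: trig_closure_trig. Qed.

Lemma indic_pred (p : pred R) x : \1_[set x | p x] x = (p x)%:R :> R.
Proof. by rewrite indicE; congr (nat_of_bool _)%:R; apply/idP/idP; rewrite inE. Qed.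

Lemma indic_trivIset (F : nat -> set R) x : trivIset setT F ->
  (forall n, \sum_(k < n) \1_(F k) x = 0 :> R) /\ \1_(\bigcup_k F k) x = 0 :> R \/
  exists k0, (forall n, \sum_(k < n) \1_(F k) x = (k0 < n)%N%:R :> R) /\
    \1_(\bigcup_k F k) x = 1 :> R.
Proof.
move=> tF; have [[k0 Fx]|nF] := pselect (exists k, F k x); last first.
  left; split=> [n|].
    rewrite big1// => k _; rewrite indicE memNset// => Fx.
    by apply: nF; exists k.
  by rewrite indicE memNset// => -[k _ Fx]; apply: nF; exists k.
right; exists k0; split; last by rewrite indicE mem_set//; exists k0.
elim=> [|n IH]; first by rewrite big_ord0.
rewrite big_ord_recr/= IH [in RHS]ltnS [in RHS]leq_eqVlt.
have -> : \1_(F n) x = (n == k0)%:R :> R.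
  rewrite indicE; congr (nat_of_bool _)%:R; apply/idP/eqP => [|->]; rewrite inE//.
  by move=> Fnx; apply: tF => //; exists x.
by rewrite eq_sym -natrD; congr (_%:R); case: ltngtP.
Qed.

Lemma cvg_sqr_dist0 (a : R) (u : nat -> R) : u n @[n --> \oo] --> a ->
  (a - u n) ^+ 2 @[n --> \oo] --> (0 : R).
Proof.
move=> ua; rewrite (_ : 0 = (a - a) * (a - a)); last by rewrite subrr mul0r.
by apply: cvgM; apply: cvgB => //; exact: cvg_cst.
Qed.

Definition indicC (A : set R) (x : R) : C := (\1_A x)%:C%C.

Lemma cmfun_indicC (A : set (measurableTypeR R)) : measurable A ->
  @cmfun R _ (measurableTypeR R) (indicC A).
Proof. by move=> mA; apply: cmfun_real; exact: measurable_indic. Qed.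

Lemma integrable_cst1 : mu.-integrable setT (EFin \o (fun=> 1 : R)).
Proof. by apply: bmfun_integrable; exact: bmfun_cst. Qed.

Lemma sqr_dist01 (a b : R) : 0 <= a <= 1 -> 0 <= b <= 1 -> (a - b) ^+ 2 <= 1.
Proof. by move=> a01 b01; nra. Qed.

Lemma indic_01 (A : set R) x : 0 <= (\1_A x : R) <= 1.
Proof. by rewrite indicE; case: (_ \in _); rewrite ?lexx ?ler01. Qed.

(** The sublevel set of the sine is the set w <= 0, where w is the affine
    function of the sine normalized to take its values in [-1, 1]; the
    polynomials step_approx n w then converge boundedly to its indicator. *)
Lemma closure_ray (a : R) : closure (indicC [set x | x <= a]).
Proof.
have [b xb] := ray_sin a.
pose K := 1 + `|b|; have K0 : 0 < K by rewrite ltr_wpDr.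
pose w x := (sin (pi * x / 4) - b) / K.
have w1 x : -1 <= w x <= 1.
  rewrite -ler_norml normrM normfV (gtr0_norm K0) ler_pdivrMr// mul1r.
  by rewrite (le_trans (ler_normB _ _))// lerD2r sin_max.
have w0 x : `|x| <= 2 -> (x <= a) = (w x <= 0).
  by move=> x2; rewrite xb// /w pmulr_lle0 ?invr_gt0// subr_le0.
have pw : real_trig_poly w.
  apply: real_trig_polyM; last exact: real_trig_poly_cst.
  by apply: real_trig_polyD real_trig_poly_sin _; exact: real_trig_poly_cst.
have [N [mN N0 subN]] := mu_support.
apply: (@trig_closure_dominated _ _ _ (fun n x => (step_approx n (w x))%:C%C) _ (fun=> 1)).
- by move=> n; exact/closure_trig_poly/real_trig_poly_step.
- apply: cmfun_indicC; rewrite (_ : [set x | x <= a] = `]-oo, a]%classic).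
    exact: measurable_itv.
  by apply/seteqP; split => x /=; rewrite in_itv.
- exact: integrable_cst1.
- exists N; split => // x nx; apply: subN => x2; apply: nx.
  rewrite /=; under eq_fun do rewrite /indicC sqn_realB.
  have -> : (\1_[set x | x <= a] x : R) = (w x <= 0)%R%:R.
    by rewrite (indic_pred (fun x => x <= a)) w0.
  by apply: cvg_sqr_dist0; exact: cvg_step_approx.
- apply: aeW => x n; rewrite /indicC sqn_realB sqr_dist01 ?indic_01//.
  exact: step_approx_01.
Qed.

(** By the pi-lambda theorem, from half-open intervals to all Borel sets. *)
Lemma closure_indic (A : set (measurableTypeR R)) : measurable A -> closure (indicC A).
Proof.
move=> mA; move: A mA.
apply: (@dynkin_induction _ (measurableTypeR R) (R.-ocitv.-measurable)
  [set A | closure (indicC A)]) => //=.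
- exact: ocitvI.
- apply: closure_trig_poly; apply: eq_trig_poly (trig_poly_cst 1) => x.
  by rewrite /indicC indicT.
- move=> _ /ocitvP[->|[[a b] /= ab ->]].
    apply: closure_trig_poly; apply: eq_trig_poly (trig_poly_cst 0) => x.
    by rewrite /indicC indic0.
  rewrite (_ : indicC _ = fun x => indicC [set x | x <= b] x - indicC [set x | x <= a] x).
    by apply: trig_closureB; exact: closure_ray.
  apply/funext => x; rewrite /indicC -rmorphB; congr (_%:C)%C.
  rewrite (indic_pred (fun x => x \in `]a, b])) in_itv/=.
  rewrite (indic_pred (fun x => x <= a)) (indic_pred (fun x => x <= b)).
  case: (leP x a) => [xa|ax] /=; last by rewrite subr0.
  by rewrite (le_trans xa (ltW ab)) subrr.
- move=> S mS cS.
  rewrite (_ : indicC _ = fun x => 1 - indicC S x).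
    by apply: trig_closureB => //; exact/closure_trig_poly/trig_poly_cst.
  apply/funext => x; rewrite /indicC -[1]/((1 : R)%:C%C) -rmorphB; congr (_%:C)%C.
  by rewrite !indicE in_setC; case: (_ \in _); rewrite ?subrr ?subr0.
move=> F mF tF cF.
pose G n x : C := \sum_(k < n) indicC (F k) x.
apply: (@trig_closure_dominated _ _ _ G _ (fun=> 1)).
- by move=> n; apply: trig_closure_sum => k _; exact: cF.
- by apply: cmfun_indicC; exact: bigcup_measurable.
- exact: integrable_cst1.
- apply: aeW => x; rewrite /G /indicC.
  under eq_fun do rewrite -rmorph_sum sqn_realB.
  have [[h ->]|[k0 [h ->]]] := indic_trivIset x tF.
    by under eq_fun do rewrite h subrr expr0n; exact: cvg_cst.
  apply: cvg_near_cst; exists k0.+1 => // n /= k0n.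
  by rewrite h k0n subrr expr0n.
- apply: aeW => x n; rewrite /G /indicC -rmorph_sum sqn_realB sqr_dist01 ?indic_01//.
  have [[h _]|[k0 [h _]]] := indic_trivIset x tF; rewrite h ?lexx ?ler01//.
  by case: (_ < _)%N; rewrite ?lexx ?ler01.
Qed.

(** Simple functions increase to f, and the squared errors are dominated by
    f^2. *)
Lemma closure_ge0 (f : R -> R) : measurable_fun setT (f : measurableTypeR R -> R) ->
  (forall x, 0 <= f x) -> mu.-integrable setT (EFin \o (fun x => f x ^+ 2)) ->
  closure (fun x => (f x)%:C%C).
Proof.
move=> mf f0 if2.
have mf' : measurable_fun setT (EFin \o f : measurableTypeR R -> \bar R).
  exact/measurable_EFinP.
pose g := nnsfun_approx (@measurableT _ (measurableTypeR R)) mf'.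
have f0' (x : measurableTypeR R) : setT x -> (0 <= (EFin \o f) x)%E by rewrite /= lee_fin.
have g_le n x : 0 <= g n x <= f x.
  apply/andP; split; first exact: fun_ge0.
  by rewrite -lee_fin /g nnsfun_approxE; exact: le_approx.
apply: (@trig_closure_dominated _ _ _ (fun n x => (g n x)%:C%C) _ (fun x => f x ^+ 2)).
- move=> n.
  rewrite (_ : (fun _ => _) = fun x => \sum_(y <- finmap.enum_fset (fset_set (range (g n))))
      y%:C%C * indicC (g n @^-1` [set y]) x).
    apply: trig_closure_sum => y _; apply: trig_closureZ; apply: closure_indic.
    exact: measurable_sfunP.
  apply/funext => x; rewrite fimfunE fsbig_finite//= rmorph_sum; apply: eq_bigr => y _.
  by rewrite rmorphM.
- exact: cmfun_real.
- exact: if2.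
- apply: aeW => x; under eq_fun do rewrite sqn_realB.
  have cg : g n x @[n --> \oo] --> f x.
    have /fine_cvg := @cvg_nnsfun_approx _ _ _ _ (@measurableT _ (measurableTypeR R)) _ mf' f0' x I.
    exact.
  exact: cvg_sqr_dist0.
- apply: aeW => x n; rewrite sqn_realB; have := g_le n x; nra.
Qed.

(** Real and imaginary parts are split into positive and negative parts, to which
    closure_ge0 applies. *)
Lemma closure_L2 F : L2 mu F -> closure F.
Proof.
move=> [mRe mIm]; rewrite L2norm_lty => eF.
have iF : mu.-integrable setT (EFin \o (fun x => sqn (F x))).
  apply/integrableP; split; first exact/measurable_EFinP/measurable_sqn.
  by under eq_integral do rewrite /= ger0_norm ?sqn_ge0//.
have part (g : R -> R) : measurable_fun setT (g : measurableTypeR R -> R) ->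
    (forall x, g x ^+ 2 <= sqn (F x)) -> closure (fun x => (g x)%:C%C).
  move=> mg gF.
  have ge0 (h : R -> R) : measurable_fun setT (h : measurableTypeR R -> R) ->
      (forall x, 0 <= h x <= `|g x|) -> closure (fun x => (h x)%:C%C).
    move=> mh hg; apply: closure_ge0 => //; first by move=> x; have /andP[] := hg x.
    apply: le_integrable iF => //; first exact/measurable_EFinP/measurable_funX.
    move=> x _ /=; rewrite lee_fin !ger0_norm ?sqr_ge0 ?sqn_ge0// (le_trans _ (gF x))//.
    by rewrite -(real_normK (num_real (g x))) lerXn2r ?nnegrE//; have /andP[] := hg x.
  rewrite (_ : (fun _ => _) = fun x => (Num.max (g x) 0)%:C%C - (Num.max (- g x) 0)%:C%C).
    apply: trig_closureB; apply: ge0.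
    - by apply: measurable_maxr => //; exact: measurable_cst.
    - by move=> x; rewrite le_max lexx orbT ge_max ler_norm normr_ge0.
    - by apply: measurable_maxr; [exact: measurableT_comp|exact: measurable_cst].
    - by move=> x; rewrite le_max lexx orbT ge_max -normrN ler_norm normr_ge0.
  apply/funext => x; rewrite -rmorphB; congr (_%:C)%C.
  by case: (leP (g x) 0) => g0; [rewrite max_l ?oppr_ge0//|rewrite max_r ?oppr_le0 ?ltW//]; lra.
rewrite (_ : F = fun x => (Re (F x))%:C%C + (0 +i* 1)%C * (Im (F x))%:C%C).
  apply: trig_closureD; last apply: trig_closureZ.
  - by apply: part => // x; rewrite lerDl sqr_ge0.
  - by apply: part => // x; rewrite lerDr sqr_ge0.
apply/funext => x.
by apply: complex_ext; rewrite !(cReD, cImD, cReM, cImM)/=; ring.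
Qed.
End totality.

(** * Finite expansions and their defect *)

Lemma ler_sum_uniq_sub (R : numDomainType) (I : eqType) (s s' : seq I)
    (F : I -> R) : uniq s -> uniq s' ->
  {subset s <= s'} -> (forall x, 0 <= F x) ->
  \sum_(x <- s) F x <= \sum_(x <- s') F x.
Proof.
move=> us us' ss' F0; rewrite [leRHS](bigID (mem s))/= -[X in X + _]big_filter.
have ps : perm_eq [seq x <- s' | x \in s] s.
  apply: uniq_perm; rewrite ?filter_uniq// => x; rewrite mem_filter/= andbC.
  by case xs: (x \in s); [rewrite (ss' _ xs)|rewrite andbF].
by rewrite (perm_big _ ps)/= lerDl sumr_ge0.
Qed.

Section digits.
Context (R : realType) (m : nat) (c : 'I_m -> int).
Hypothesis c_odd : forall i, ~~ (2 %| c i)%Z.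
Local Notation C := R[i].

(** The sums of 4^k a_k over the positions of u.  The recursion adds a new lowest
    digit, as self-similarity of the measure requires, whereas extending a prefix
    adds a highest digit; expansionsP reconciles the two. *)
Fixpoint expansions (u : seq 'I_m) : seq int :=
  if u is i :: v then
    [seq 4 * x | x <- expansions v] ++ [seq c i + 4 * x | x <- expansions v]
  else [:: 0].

Let c_half i : exists q, c i = 2 * q + 1.
Proof.
exists (c i %/ 2)%Z; rewrite {1}(divz_eq (c i) 2) mulrC; congr (_ + _).
have nz : (c i %% 2)%Z <> 0 by move=> /dvdz_mod0P; exact/negP/c_odd.
move: nz; have := modz_ge0 (c i) (isT : 2 != 0 :> int).
by have := ltz_mod (c i) (isT : 2 != 0 :> int); lia.
Qed.

(** At the lowest position k where two expansions differ, the digits are 0 and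
    an odd number, so that the difference is 4^k times an odd integer. *)
Lemma expansions_sub u : uniq (expansions u) /\
  {in expansions u &, forall x y, x != y -> exists k j, x - y = 4 ^+ k * (2 * j + 1)}.
Proof.
elim: u => [|i u [uniq_u sub_u]].
  by split=> // x y; rewrite !inE => /eqP -> /eqP ->; rewrite eqxx.
have [q cq] := c_half i; split.
  rewrite /= cat_uniq !map_inj_uniq ?uniq_u ?andbT/=.
  - by apply/hasPn => _ /mapP[x _ ->]; apply/negP => /mapP[y _]; lia.
  - by move=> x y; lia.
  - by move=> x y; lia.
have same x y a b : x \in expansions u -> y \in expansions u -> a - b = 4 * (x - y) ->
    a != b -> exists k j, a - b = 4 ^+ k * (2 * j + 1).
  move=> xu yu ab nab; have xy : x != y by apply: contraNneq nab => xy; lia.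
  by have [k [j E]] := sub_u x y xu yu xy; exists k.+1, j; rewrite ab E exprS mulrA.
move=> a b; rewrite /= !mem_cat.
move=> /orP[]/mapP[x xu ->] /orP[]/mapP[y yu ->].
- by apply: (same x y) => //; lia.
- by exists 0%N, (2 * x - 2 * y - q - 1); rewrite cq expr0; lia.
- by exists 0%N, (2 * x - 2 * y + q); rewrite cq expr0; lia.
- by apply: (same x y) => //; lia.
Qed.

Lemma expansionsP (w : nat -> 'I_m) n x : reflect
  (exists a : nat -> int, (forall k, (k < n)%N -> a k = 0 \/ a k = c (w k)) /\
    x = \sum_(k < n) 4 ^+ k * a k)
  (x \in expansions (mkseq w n)).
Proof.
apply: (iffP idP).
  elim: n w x => [|n IH] w x.
    by rewrite inE => /eqP ->; exists (fun=> 0); split => //; rewrite big_ord0.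
  have -> : mkseq w n.+1 = w 0%N :: mkseq (w \o succn) n.
    by rewrite /mkseq/= (iotaDl 1) -map_comp.
  rewrite /= mem_cat => /orP[]/mapP[y /IH[a [aw ->]] ->].
    exists (fun k => if k is k'.+1 then a k' else 0); split.
      by case=> [|k] kn; [left|exact: aw].
    rewrite big_ord_recl mulr0 add0r mulr_sumr; apply: eq_bigr => k _ /=.
    by rewrite exprS mulrA.
  exists (fun k => if k is k'.+1 then a k' else c (w 0%N)); split.
    by case=> [|k] kn; [right|exact: aw].
  rewrite big_ord_recl expr0 mul1r mulr_sumr; congr (_ + _); apply: eq_bigr => k _ /=.
  by rewrite exprS mulrA.
elim: n w x => [|n IH] w x [a [aw ->]]; first by rewrite big_ord0.
have -> : mkseq w n.+1 = w 0%N :: mkseq (w \o succn) n.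
  by rewrite /mkseq/= (iotaDl 1) -map_comp.
have IHn : \sum_(k < n) 4 ^+ k * a k.+1 \in expansions (mkseq (w \o succn) n).
  by apply: IH; exists (a \o succn); split => // k kn; exact: (aw k.+1).
rewrite big_ord_recl expr0 mul1r /= mem_cat; apply/orP.
have -> : \sum_(i < n) 4 ^+ bump 0 i * a (bump 0 i) = 4 * \sum_(k < n) 4 ^+ k * a k.+1.
  by rewrite mulr_sumr; apply: eq_bigr => k _; rewrite /bump/= add1n exprS mulrA.
by case: (aw 0%N isT) => ->; [left; rewrite add0r|right]; apply/mapP; eexists; eauto.
Qed.

Lemma expansions_mono (w : nat -> 'I_m) n n' : (n <= n')%N ->
  {subset expansions (mkseq w n) <= expansions (mkseq w n')}.
Proof.
move=> nn' x /expansionsP[a [aw ->]]; apply/expansionsP.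
exists (fun k => if (k < n)%N then a k else 0); split.
  by move=> k _; case: ifP => kn; [exact: aw|left].
rewrite (big_ord_widen n' (fun k => 4 ^+ k * a k))// big_mkcond.
by apply: eq_bigr => k _; case: ifP; rewrite ?mulr0.
Qed.

Definition real_expansions u : seq R := [seq x%:~R | x <- expansions u].

Lemma Lambda_expansions (w : nat -> 'I_m) (x : R) :
  Lambda c w x <-> exists n, x \in real_expansions (mkseq w n).
Proof.
split=> [[n [a [n1 aw ->]]]|[n /mapP[z zw ->]]].
  by exists n; apply/map_f/expansionsP; exists a.
have /expansionsP[a [aw ->]] := expansions_mono (leqnSn n) zw.
by exists n.+1, a.
Qed.

Lemma real_expansions_mono (w : nat -> 'I_m) n n' : (n <= n')%N ->
  {subset real_expansions (mkseq w n) <= real_expansions (mkseq w n')}.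
Proof. by move=> nn' _ /mapP[z /(expansions_mono nn') zw ->]; exact: map_f. Qed.

Variable mu : probability (measurableTypeR R) R.
Hypothesis mu_cantor : middle_fourth_cantor mu.

Lemma uniq_real_expansions u : uniq (real_expansions u).
Proof.
by rewrite map_inj_uniq; [have [] := expansions_sub u|exact: intr_inj].
Qed.

Lemma fourier_expansions u :
  {in real_expansions u &, forall x y, x != y -> fourier mu (x - y) = 0}.
Proof.
move=> _ _ /mapP[x xu ->] /mapP[y yu ->] xy.
have nxy : x != y by apply: contraNneq xy => ->.
have [_ /(_ x y xu yu nxy) [k [j E]]] := expansions_sub u.
by rewrite -intrB E; exact: fourier_pow4_odd.
Qed.

(** The squared distance from e_t to the span of the exponentials with
    frequencies in the expansions of u. *)
Definition defect u (t : R) : R :=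
  1 - \sum_(x <- real_expansions u) sqn (fourier mu (t - x)).

Lemma pythagoras_defect u t :
  energy mu (fun x => expi t x - \sum_(i <- real_expansions u) fourier mu (t - i) * expi i x) =
  (defect u t)%:E.
Proof.
rewrite (pythagoras _ (fun i => fourier mu (t - i)) (uniq_real_expansions u)
  (@fourier_expansions u)).
congr EFin; rewrite /defect [X in _ + X]big1 ?addr0// => i _.
by rewrite subrr /sqn/= expr0n/= addr0.
Qed.

Lemma defect_ge0 u t : 0 <= defect u t.
Proof. by rewrite -lee_fin -pythagoras_defect energy_ge0. Qed.

Lemma sqn_fourier_even (t : R) (z : int) :
  sqn (fourier mu (t - (4 * z)%:~R)) =
  cos (pi * t / 2) ^+ 2 * sqn (fourier mu (t / 4 - z%:~R)).
Proof.
rewrite sqn_fourier// cos_sqr_even; do 2 f_equal; congr fourier.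
by rewrite intrM; field.
Qed.

Lemma sqn_fourier_odd (t : R) i (z : int) :
  sqn (fourier mu (t - (c i + 4 * z)%:~R)) =
  sin (pi * t / 2) ^+ 2 * sqn (fourier mu ((t - (c i)%:~R) / 4 - z%:~R)).
Proof.
have [q cq] := c_half i.
rewrite sqn_fourier// {1}cq cos_sqr_odd; do 2 f_equal; congr fourier.
by rewrite intrD intrM; field.
Qed.

Lemma defect_nil t : defect [::] t = 1 - sqn (fourier mu t).
Proof. by rewrite /defect big_seq1 subr0. Qed.

(** The recursion behind the transfer operator. *)
Lemma defect_cons i u t : defect (i :: u) t =
  cos (pi * t / 2) ^+ 2 * defect u (t / 4) +
  sin (pi * t / 2) ^+ 2 * defect u ((t - (c i)%:~R) / 4).
Proof.
rewrite /defect /real_expansions /= map_cat big_cat !big_map/=.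
under eq_bigr do rewrite sqn_fourier_even.
under [in X in _ - (_ + X)]eq_bigr do rewrite sqn_fourier_odd.
by rewrite -!mulr_sumr sin2cos2; ring.
Qed.

(** Bessel's inequality improves with the number of frequencies. *)
Lemma defect_le (w : nat -> 'I_m) n (s : seq R) t : uniq s ->
  {subset s <= real_expansions (mkseq w n)} ->
  defect (mkseq w n) t <= 1 - \sum_(x <- s) sqn (fourier mu (t - x)).
Proof.
move=> us sub; rewrite lerD2l lerN2.
by apply: ler_sum_uniq_sub => //; [exact: uniq_real_expansions|move=> x; exact: sqn_ge0].
Qed.

Section word.
Variable w : nat -> 'I_m.

Lemma Lambda_sub_expansions (s : seq R) : (forall i, i \in s -> Lambda c w i) ->
  exists n, {subset s <= real_expansions (mkseq w n)}.
Proof.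
elim: s => [|x s IH] sL; first by exists 0%N.
have [n sn] := IH (fun i si => sL i (mem_behead (s := x :: s) si)).
have [k xk] := (Lambda_expansions w x).1 (sL x (mem_head x s)).
exists (maxn n k) => y; rewrite inE => /orP[/eqP ->|/sn].
  exact: real_expansions_mono (leq_maxr n k) _ xk.
exact: real_expansions_mono (leq_maxl n k) _.
Qed.

Lemma Lambda_isolated : @Lambda R m c w `<=` isolated (@Lambda R m c w).
Proof.
move=> x xL; split; first by rewrite inE.
exists (ball x 1); first exact: nbhsx_ballx.
apply/seteqP; split => [y [xy yL]|y ->]; last by split => //; exact: ballxx.
have [[n /mapP[z _ xz]] [k /mapP[z' _ yz']]] :=
  ((Lambda_expansions w x).1 xL, (Lambda_expansions w y).1 yL).
move: xy; rewrite /ball/= xz yz' -intrB -intr_norm (ltr_int _ _ 1) => zz'.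
by congr (_%:~R); lia.
Qed.

Lemma Lambda_orthonormal (x y : R) : Lambda c w x -> Lambda c w y ->
  L2inner mu (expi x) (expi y) = (x == y)%:R.
Proof.
move=> xL yL; rewrite L2inner_expi.
have [->|xy] := eqVneq; first by rewrite subrr fourier0.
have [|n sn] := @Lambda_sub_expansions [:: x; y].
  by move=> i; rewrite !inE => /orP[]/eqP ->.
by apply: (@fourier_expansions (mkseq w n)) => //; apply: sn; rewrite !inE eqxx ?orbT.
Qed.

(** The criterion for completeness.  If the system is complete, e_t is close to a
    combination of finitely many of its members, and all of them occur at some
    finite stage, whose defect is no larger than the error.  Conversely, small
    defects put the total family (e_t), t in (1/8)Z, into the closed span. *)
Lemma spectrum_Lambda : is_spectrum mu (Lambda c w) <->
  forall t, grid t -> forall e, 0 < e -> exists n, defect (mkseq w n) t < e.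
Proof.
split=> [[_ [_ _ dense]] t _ e e0|small].
  have se0 : 0 < Num.sqrt e by rewrite sqrtr_gt0.
  have [s [a [sL]]] := dense _ (L2_cbmfun mu (cbmfun_expi t)) _ se0.
  rewrite L2norm_lt// sqr_sqrtr ?ltW// => es.
  pose l := [seq (i, a i) | i <- s].
  have [s' [a' [us' ss' l'E]]] := trig_uniq l.
  have {}ss' : {subset s' <= s}.
    by move=> i /ss'; rewrite -map_comp map_id.
  have [n s'n] := @Lambda_sub_expansions s' (fun i si => sL i (ss' i si)).
  exists n; rewrite -lte_fin; apply: le_lt_trans es.
  rewrite (_ : (fun _ => _) = fun x => expi t x - \sum_(i <- s') a' i * expi i x).
    rewrite pythagoras//; last first.
      by move=> x y /s'n xn /s'n yn; exact: (@fourier_expansions (mkseq w n)).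
    rewrite lee_fin (le_trans (defect_le _ us' s'n))// lerDl sumr_ge0// => i _.
    exact: sqn_ge0.
  by apply/funext => x; rewrite -l'E /trig big_map.
split; first exact: Lambda_isolated.
split.
- by move=> t _; exact/L2_cbmfun/cbmfun_expi.
- by move=> x y xL yL; exact: Lambda_orthonormal.
move=> f /(closure_L2 (support_cantor mu_cantor)) fgrid e e0.
have [_ /(_ (e ^+ 2))] : trig_closure mu (Lambda c w) f.
  apply: trig_closure_trans fgrid => t tgrid; split.
    exact/cbmfun_cmfun/cbmfun_expi.
  move=> d d0; have [n tn] := small t tgrid d d0.
  exists [seq (i, fourier mu (t - i)) | i <- real_expansions (mkseq w n)]; split.
    by move=> _ /mapP[i ni ->]; apply/Lambda_expansions; exists n.
  rewrite (_ : (fun _ => _) = fun x => expi t x -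
      \sum_(i <- real_expansions (mkseq w n)) fourier mu (t - i) * expi i x).
    by rewrite pythagoras_defect lte_fin.
  by apply/funext => x; rewrite /trig big_map.
case=> [|l [lL fl]]; first by rewrite exprn_gt0.
have [s [a [_ ss lE]]] := trig_uniq l.
exists s, a; split; first by move=> i /ss /mapP[p pl ->]; exact: lL.
by rewrite L2norm_lt//; under eq_fun do rewrite -lE.
Qed.
End word.
End digits.

(** * The average of the defect over words of given length *)

Section average.
Context (R : realType) (m : nat) (c : 'I_m.+1 -> int).
Hypothesis c_odd : forall i, ~~ (2 %| c i)%Z.
Variable mu : probability (measurableTypeR R) R.
Hypothesis mu_cantor : middle_fourth_cantor mu.

Lemma sum_tuple_cons n (F : seq 'I_m.+1 -> R) :
  \sum_(u : n.+1.-tuple 'I_m.+1) F u =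
  \sum_i \sum_(v : n.-tuple 'I_m.+1) F (i :: v).
Proof.
rewrite pair_big/=.
rewrite (reindex (fun p : 'I_m.+1 * n.-tuple 'I_m.+1 => cons_tuple p.1 p.2))//=.
exists (fun u : n.+1.-tuple 'I_m.+1 => (thead u, behead_tuple u)) => [[i v] _|u _] /=.
  by congr pair; apply: val_inj.
by rewrite [RHS]tuple_eta.
Qed.

Definition defect0 (t : R) : R := 1 - sqn (fourier mu t).
Definition digit i : R := (c i)%:~R.

(** The first letter of a random word selects the map t |-> (t - c_i)/4, and the
    remaining ones form an independent random word of length n. *)
Lemma average_defect n t :
  (\sum_(u : n.-tuple 'I_m.+1) defect c mu u t) / m.+1%:R ^+ n =
  iter n (transfer digit) defect0 t.
Proof.
elim: n t => [|n IH] t.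
  rewrite expr0 divr1 (big_pred1 [tuple]) ?defect_nil// => u.
  by apply/esym/eqP; rewrite tuple0.
have m0 : m.+1%:R != 0 :> R by rewrite pnatr_eq0.
rewrite iterS /transfer -IH.
have -> : mean (fun i => iter n (transfer digit) defect0 ((t - digit i) / 4)) =
    mean (fun i => (\sum_(u : n.-tuple 'I_m.+1) defect c mu u ((t - digit i) / 4)) /
                   m.+1%:R ^+ n).
  by congr (_ / _); apply: eq_bigr => i _; rewrite IH.
rewrite /mean.
rewrite -mulr_suml (sum_tuple_cons n (fun u => defect c mu u t)).
under eq_bigr do under eq_bigr do rewrite (defect_cons c_odd mu_cantor).
under eq_bigr do rewrite big_split -!mulr_sumr /=.
rewrite big_split -!mulr_sumr/= sumr_const card_ord.
have -> : m.+1%:R ^+ n.+1 = m.+1%:R * m.+1%:R ^+ n :> R by rewrite exprS.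
rewrite -[(\sum_u _) *+ _]mulr_natr.
move: (m.+1%:R) m0 => k k0; have := expf_neq0 n k0; move: (k ^+ n) => M M0.
by rewrite /digit; field; rewrite k0 M0.
Qed.

Hypothesis c_mod : exists i j, exists z, c j = c i + 2 + 4 * z.

Lemma average_defect_cvg0 t :
  (\sum_(u : n.-tuple 'I_m.+1) defect c mu u t) / m.+1%:R ^+ n @[n --> \oo] --> (0 : R).
Proof.
under eq_fun do rewrite average_defect.
have [i [j [z cij]]] := c_mod.
apply: (@iter_transfer_cvg0 _ _ digit defect0 (16 * pi) _ _ _ _ _ i j).
- by have := pi_ge0 R; lra.
- by move=> s; rewrite /defect0 subr_ge0 sqn_fourier_le1 gerBl sqn_ge0.
- move=> s u; have -> : defect0 s - defect0 u = sqn (fourier mu u) - sqn (fourier mu s).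
    by rewrite /defect0; ring.
  by rewrite distrC; exact: sqn_fourier_lipschitz.
- move=> s; rewrite /transfer {3}/defect0 sqn_fourier//.
  have le1 : mean (fun l => defect0 ((s - digit l) / 4)) <= 1.
    by rewrite -(mean_cst m 1); apply: ler_mean => l; rewrite /defect0 gerBl sqn_ge0.
  rewrite (le_trans (lerD (lexx _) (ler_wpM2l (sqr_ge0 _) le1)))//.
  by rewrite sin2cos2 /defect0; lra.
- by rewrite /defect0 fourier0 /sqn/= expr1n expr0n/= addr0 subrr.
- by move=> s; exact: cos_antiperiod cij.
Qed.

End average.

(** * Sets of words determined by a prefix *)

Section words.
Context (R : realType) (m : nat).
Variable P : probability (wordspace m) R.
Hypothesis P_uniform : uniform_bernoulli P.

Lemma measurable_cylinder n (u : n.-tuple 'I_m.+1) :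
  measurable (cylinder u : set (wordspace m)).
Proof. by apply: sub_sigma_algebra; exists n, u. Qed.

Lemma cylinder_mkseq n (u : n.-tuple 'I_m.+1) (w : wordspace m) :
  cylinder u w <-> mkseq w n = u.
Proof.
split=> [wu|wu k].
  apply: (@eq_from_nth _ ord0); rewrite size_mkseq ?size_tuple// => k kn.
  by rewrite nth_mkseq// (wu (Ordinal kn)) (tnth_nth ord0).
by rewrite (tnth_nth ord0) -wu nth_mkseq.
Qed.

Lemma prefix_set n (p : pred (seq 'I_m.+1)) :
  [set w : wordspace m | p (mkseq w n)] =
  \big[setU/set0]_(u : n.-tuple 'I_m.+1 | p u) (cylinder u : set (wordspace m)).
Proof.
rewrite -bigcup_pred; apply/seteqP; split => w /=.
  move=> pw; have sz : size (mkseq w n) == n by rewrite size_mkseq.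
  by exists (Tuple sz) => //; apply/cylinder_mkseq.
by move=> [u /= pu /cylinder_mkseq ->].
Qed.

Lemma measurable_prefix_set n (p : pred (seq 'I_m.+1)) :
  measurable [set w : wordspace m | p (mkseq w n)].
Proof.
by rewrite prefix_set; apply: bigsetU_measurable => u _; exact: measurable_cylinder.
Qed.

Lemma le_prefix_set n (p : pred (seq 'I_m.+1)) :
  (P [set w : wordspace m | p (mkseq w n)] <=
   (\sum_(u : n.-tuple 'I_m.+1 | p u) m.+1%:R ^- n)%:E)%E.
Proof.
rewrite prefix_set -sumEFin.
suff [] : measurable (\big[setU/set0]_(u : n.-tuple 'I_m.+1 | p u)
      (cylinder u : set (wordspace m))) /\
    (P (\big[setU/set0]_(u : n.-tuple 'I_m.+1 | p u) (cylinder u : set (wordspace m))) <=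
     \sum_(u : n.-tuple 'I_m.+1 | p u) (m.+1%:R ^- n)%:E)%E by [].
apply: (big_ind2 (fun (A : set (wordspace m)) x => measurable A /\ (P A <= x)%E)).
- by rewrite measure0.
- move=> A x B y [mA Ax] [mB By]; split; first exact: measurableU.
  by rewrite (le_trans (measureU2 _ mA mB))// leeD.
- by move=> u _; split; [exact: measurable_cylinder|rewrite P_uniform].
Qed.
End words.

(** * Almost every word yields a spectrum *)

Section almost_every_word.
Context (R : realType) (m : nat) (c : 'I_m.+1 -> int).
Hypothesis c_odd : forall i, ~~ (2 %| c i)%Z.
Hypothesis c_mod : exists i j, exists z, c j = c i + 2 + 4 * z.
Variable mu : probability (measurableTypeR R) R.
Hypothesis mu_cantor : middle_fourth_cantor mu.
Variable P : probability (wordspace m) R.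
Hypothesis P_uniform : uniform_bernoulli P.

Definition large_defect (r t : R) n : set (wordspace m) :=
  [set w | r <= defect c mu (mkseq w n) t].

Lemma measurable_large_defect r t n : measurable (large_defect r t n).
Proof. exact: (measurable_prefix_set n (fun u => r <= defect c mu u t)). Qed.

(** Markov's inequality. *)
Lemma le_large_defect r t n : 0 < r -> (P (large_defect r t n) <=
  (r^-1 * ((\sum_(u : n.-tuple 'I_m.+1) defect c mu u t) / m.+1%:R ^+ n))%:E)%E.
Proof.
move=> r0; apply: le_trans (le_prefix_set P_uniform n (fun u => r <= defect c mu u t)) _.
rewrite lee_fin mulr_suml mulr_sumr big_mkcond; apply: ler_sum => u _.
have d0 : 0 <= defect c mu u t by exact: defect_ge0.
have i0 : 0 <= m.+1%:R ^- n :> R by rewrite invr_ge0 exprn_ge0.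
case: ifPn => [ru|_]; last by rewrite !mulr_ge0// invr_ge0 ltW.
by rewrite mulrA -[leLHS]mul1r ler_wpM2r// ler_pdivlMl// mulr1.
Qed.

(** The words all of whose prefixes have a defect at least r at t lie in each
    large_defect set, whose measure tends to 0. *)
Lemma large_defect_null r t : 0 < r -> P (\bigcap_n large_defect r t n) = 0.
Proof.
move=> r0; have mB n := measurable_large_defect r t n.
have mD : measurable (\bigcap_n large_defect r t n) by exact: bigcapT_measurable.
apply/le_anti; rewrite measure_ge0 andbT.
have fin : P (\bigcap_n large_defect r t n) \is a fin_num by exact: fin_num_measure.
rewrite -[leLHS]fineK// lee_fin.
have cv : r^-1 * ((\sum_(u : n.-tuple 'I_m.+1) defect c mu u t) / m.+1%:R ^+ n)
    @[n --> \oo] --> (0 : R).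
  rewrite -[X in _ --> X](mulr0 r^-1).
  apply: cvgM; [exact: cvg_cst|exact: average_defect_cvg0].
rewrite -(cvg_lim _ cv)//; apply: limr_ge; first by apply: cvgP; exact: cv.
apply: nearW => n; rewrite -lee_fin fineK//.
apply: le_trans (le_large_defect t n r0); apply: le_measure; rewrite ?inE//.
exact: bigcap_inf.
Qed.

(** The grid is indexed by natural numbers because measurability and negligibility
    are preserved by unions of sequences. *)
Definition grid_point (k : nat) : R := (odflt 0 (unpickle k : option int))%:~R / 8.

Lemma grid_pointP t : grid t -> exists k, t = grid_point k.
Proof. by move=> [q _ <-]; exists (pickle q); rewrite /grid_point pickleK. Qed.

(** Countably many conditions on prefixes describe the exceptional words. *)
Lemma non_spectrum_set :
  [set w : wordspace m | ~ is_spectrum mu (Lambda c w)] =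
  \bigcup_k \bigcup_j \bigcap_n large_defect j.+1%:R^-1 (grid_point k) n.
Proof.
apply/seteqP; split => w /=.
  move=> nw; apply: contrapT => nD; apply: nw; apply/(spectrum_Lambda c_odd mu_cantor).
  move=> t /grid_pointP[k ->] e e0; apply: contrapT => small.
  pose j := Num.Def.archi_bound e^-1.
  apply: nD; exists k => //; exists j => // n _ /=; rewrite /large_defect/= leNgt.
  apply/negP => dj; apply: small; exists n; apply: lt_le_trans dj _.
  rewrite invf_ple ?posrE// ltW// (lt_trans (archi_boundP _))// ?invr_ge0 ?ltW//.
  by rewrite ltr_nat.
move=> [k _ [j _ D]] /(spectrum_Lambda c_odd mu_cantor) /(_ (grid_point k)).
have gk : grid (grid_point k) by eexists.
move=> /(_ gk j.+1%:R^-1); rewrite invr_gt0 ltr0n => /(_ isT)[n].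
by rewrite ltNge => /negP; apply; exact: (D n).
Qed.

Lemma non_spectrum_null :
  let N := [set w : wordspace m | ~ is_spectrum mu (Lambda c w)] in
  measurable N /\ P N = 0.
Proof.
have mD k j : measurable (\bigcap_n large_defect j.+1%:R^-1 (grid_point k) n).
  by apply: bigcapT_measurable => n; exact: measurable_large_defect.
rewrite /= non_spectrum_set; set N := \bigcup_k _.
have mN : measurable N.
  by apply: bigcup_measurable => k _; apply: bigcup_measurable => j _; exact: mD.
split=> //; apply: measure_negligible => //.
apply: negligible_bigcup => k; apply: negligible_bigcup => j.
by apply/negligibleP; [exact: mD|exact/large_defect_null].
Qed.
End almost_every_word.

(* The alphabet has m.+2 letters, where m is an arbitrary natural number. *)
Theorem theorem1p3 (R : realType)
  (mu4 : probability (measurableTypeR R) R)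
  (hmu4 : middle_fourth_cantor mu4)
  (m : nat) (c : 'I_m.+2 -> int)
  (c_inj : injective c)
  (c_odd : forall i, ~~ (2 %| c i)%Z)
  (c_mod4 : [set (c i %% 4)%Z | i in [set: 'I_m.+2]] = [set 1; 3])
  (P : probability (wordspace m.+1) R)
  (hP : uniform_bernoulli P) :
  let N : set (wordspace m.+1) :=
    [set w | ~ is_spectrum mu4 (Lambda c w)] in
  measurable N /\ P N = 0%E.
Proof.
apply: non_spectrum_null => //.
have [i _ ci] : [set (c i %% 4)%Z | i in [set: 'I_m.+2]] 1 by rewrite c_mod4; left.
have [j _ cj] : [set (c i %% 4)%Z | i in [set: 'I_m.+2]] 3 by rewrite c_mod4; right.
exists i, j, ((c j %/ 4)%Z - (c i %/ 4)%Z).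
by rewrite {1}(divz_eq (c j) 4) {1}(divz_eq (c i) 4) ci cj; ring.
Qed.
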